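(* Let $n\in\mathbb N$. The functor $$\overline{(\;)}:\mathcal T_{\le1+n}\text{-}\mathrm{NColl}\longrightarrow\mathrm{PraDist}(\widehat{\mathbb G}_{\le n})/\mathcal T_{\le n}^\times$$ which sends a normalised $(1+n)$-collection $\alpha:A\to\mathcal T_{\le1+n}$ to $\overline\alpha:\overline A\to\overline{\mathcal T_{\le1+n}}=\mathcal T_{\le n}^\times$, where $\overline A_k(X_1,\dots,X_k)=\{A(X_1,\dots,X_k)\}(0,k)$, is an equivalence of categories $$\mathcal T_{\le1+n}\text{-}\mathrm{NColl}\simeq\mathrm{PraDist}(\widehat{\mathbb G}_{\le n})/\mathcal T_{\le n}^\times .$$
   Context: **Globular sets.** For $m\in\mathbb N$, $\widehat{\mathbb G}_{\le m}$ is the category of $m$-globular sets: sets $X_j$ ($0\le j\le m$) of $j$-cells with maps $s,t:X_{j+1}\to X_j$ satisfying $ss=st$, $ts=tt$. For $0$-cells $a,b$ of a $(1+n)$-globular set $X$, the hom $X(a,b)$ is the $n$-globular set whose $j$-cells are the $(j+1)$-cells of $X$ with iterated $0$-dimensional source $a$ and target $b$. A map $f:X\to Z$ is the same thing as a function $f_0:X_0\to Z_0$ with maps $f_{a,b}:X(a,b)\to Z(f_0a,f_0b)$. A finite sequence $(X_1,\dots,X_k)$ of $n$-globular sets is regarded as a $(1+n)$-globular set with $0$-cells $\{0,\dots,k\}$, homs $(X_1,\dots,X_k)(i-1,i)=X_i$, all other homs empty. Similarly for ordinary (infinite-dimensional) globular sets. **Trees.** $\mathrm{Tr}_0=\{0\}$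 and $\mathrm{Tr}_{j+1}$ is the set of finite sequences $(p_1,\dots,p_k)$, $k\ge0$, of elements of $\mathrm{Tr}_j$. Each $p\in\mathrm{Tr}_j$ also denotes a globular set (with no cells above dimension $j$): $0$ has one $0$-cell and no other cells; $(p_1,\dots,p_k)$ is the sequence regarded as a globular set. Maps $\partial:\mathrm{Tr}_{j+1}\to\mathrm{Tr}_j$ and $\sigma_p,\tau_p:\partial p\to p$: for $p\in\mathrm{Tr}_1$, $\partial p=0$ and $\sigma_p,\tau_p$ select the least and greatest $0$-cell of $p$; for $p=(p_1,\dots,p_k)\in\mathrm{Tr}_{j+2}$, $\partial p=(\partial p_1,\dots,\partial p_k)$ and $\sigma_p,\tau_p$ are identities on $0$-cells and $\sigma_{p_i},\tau_{p_i}$ on homs. **The endofunctor $\mathcal T_{\le m}$ of $\widehat{\mathbb G}_{\le m}$.** For $j\le m$, a $j$-cell of $\mathcal T_{\le m}X$ is a pair $(p,f)$ with $p\in\mathrm{Tr}_j$, $f:p\to X$ a map of $m$-globular sets; $s(p,f)=(\partial p,f\sigma_p)$, $t(p,f)=(\partial p,f\tau_p)$; $\mathcal T_{\le m}(h)(p,f)=(p,hf)$. So $\{\mathcal T_{\le m}X\}_0=X_0$. (It underlies the strict $m$-category monad; unit and multiplication are not needed for this statement.) **Normalised collections.** A natural transformation is cartesian if its naturality squares are pullbacks. A normalised $(1+n)$-collection is an endofunctor $A$ of $\widehat{\mathbb G}_{\le1+n}$ with a cartesian transformation $\alpha:A\to\mathcal T_{\le1+n}$ whose components are identities in dimension $0$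 (so $\{AX\}_0=X_0$). $\mathcal T_{\le1+n}\text{-}\mathrm{NColl}$ has as morphisms natural transformations over $\mathcal T_{\le1+n}$ (automatically cartesian). **$\mathrm{PraDist}$.** A functor $F:\mathcal A\to\mathcal B$ is p.r.a (a parametric right adjoint) if for every $A\in\mathcal A$ the functor $\mathcal A/A\to\mathcal B/FA$ induced by $F$ has a left adjoint. $\mathrm{PraDist}(\widehat{\mathbb G}_{\le n})$ is the category whose objects are families $E=(E_k:\widehat{\mathbb G}_{\le n}^k\to\widehat{\mathbb G}_{\le n})_{k\in\mathbb N}$ of p.r.a functors each preserving coproducts in each variable, and whose morphisms are families of cartesian transformations. $\mathcal T_{\le n}^\times$ is the object with $(\mathcal T_{\le n}^\times)_k(X_1,\dots,X_k)=\prod_i\mathcal T_{\le n}X_i$. **The functor.** On a morphism $\phi$, $\overline\phi_{X_1,\dots,X_k}=\{\phi_{(X_1,\dots,X_k)}\}_{0,k}$. The identification $\overline{\mathcal T_{\le1+n}}=\mathcal T_{\le n}^\times$: a $j$-cell of $\{\mathcal T_{\le1+n}(X_1,\dots,X_k)\}(0,k)$ is a pair $(p,f)$ with, necessarily, $p=(p_1,\dots,p_k)$, $f$ the identity on $0$-cells, and hom maps $f_i:p_i\to X_i$, i.e. a $j$-cell $((p_i,f_i))_i$ of $\prod_i\mathcal T_{\le n}X_i$. *)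

(* Defs.v *)
From mathcomp Require Import all_boot.
From mathcomp Require Import boolp.
Set Implicit Arguments.
Unset Strict Implicit.
Unset Printing Implicit Defensive.

#[local] Obligation Tactic := try by [].

(* The universe of sets: cells of globular sets and index sets of coproducts
   live in this one fixed universe, strictly below the objects of categories. *)
Definition Small := Type.

Record category := Category {
  ob :> Type;
  hom : ob -> ob -> Type;
  idc : forall X, hom X X;
  cmp : forall X Y Z, hom Y Z -> hom X Y -> hom X Z;
  cmpA : forall X Y Z W (h : hom Z W) (g : hom Y Z) (f : hom X Y),
    cmp h (cmp g f) = cmp (cmp h g) f;
  cmp1 : forall X Y (f : hom X Y), cmp f (idc X) = f;
  cmp1l : forall X Y (f : hom X Y), cmp (idc Y) f = f }.

Arguments hom {c} X Y.
Arguments idc {c} X.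
Arguments cmp {c X Y Z} g f.

Declare Scope cat_scope.
Delimit Scope cat_scope with cat.
Local Open Scope cat_scope.
Notation "g '∘' f" := (cmp g f) (at level 40, left associativity) : cat_scope.

Record functor (C D : category) := Functor {
  fob :> C -> D;
  fmap : forall X Y : C, hom X Y -> hom (fob X) (fob Y);
  fmap1 : forall X, fmap (idc X) = idc (fob X);
  fmapM : forall X Y Z (g : hom Y Z) (f : hom X Y),
    fmap (g ∘ f) = fmap g ∘ fmap f }.

Arguments fmap {C D} f0 {X Y} f : rename.

Program Definition fid (C : category) : functor C C :=
  @Functor C C (fun X => X) (fun X Y f => f) _ _.

Program Definition fcomp (C D E : category) (G : functor D E) (F : functor C D) :
    functor C E :=
  @Functor C E (fun X => G (F X)) (fun X Y f => fmap G (fmap F f)) _ _.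
Next Obligation. by move=> *; rewrite /= !fmap1. Qed.
Next Obligation. by move=> *; rewrite /= !fmapM. Qed.

Record nattrans (C D : category) (F G : functor C D) := NatTrans {
  nt :> forall X : C, hom (F X) (G X);
  ntP : forall (X Y : C) (f : hom X Y), fmap G f ∘ nt X = nt Y ∘ fmap F f }.

Lemma nattrans_eq (C D : category) (F G : functor C D) (a b : nattrans F G) :
  (forall X, a X = b X) -> a = b.
Proof.
case: a b => a aP [b bP] /= ab.
have {}ab : a = b by apply: functional_extensionality_dep.
by case: _ / ab bP => bP; congr NatTrans; apply: Prop_irrelevance.
Qed.

Program Definition nt_id (C D : category) (F : functor C D) : nattrans F F :=
  @NatTrans C D F F (fun X => idc (F X)) _.
Next Obligation. by move=> *; rewrite /= cmp1 cmp1l. Qed.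

Program Definition nt_comp (C D : category) (F G H : functor C D)
    (b : nattrans G H) (a : nattrans F G) : nattrans F H :=
  @NatTrans C D F H (fun X => b X ∘ a X) _.
Next Obligation. by move=> *; rewrite /= cmpA ntP -cmpA ntP cmpA. Qed.

Definition is_iso (C : category) (X Y : C) (f : hom X Y) : Prop :=
  exists g : hom Y X, g ∘ f = idc X /\ f ∘ g = idc Y.

Definition naturally_iso (C D : category) (F G : functor C D) : Prop :=
  exists a : nattrans F G, forall X, is_iso (a X).

Definition is_equivalence (C D : category) (F : functor C D) : Prop :=
  exists G : functor D C,
    naturally_iso (fid C) (fcomp G F) /\ naturally_iso (fcomp F G) (fid D).

Definition has_left_adjoint (C D : category) (R : functor C D) : Prop :=
  exists (L : functor D C) (eta : nattrans (fid D) (fcomp R L))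
         (eps : nattrans (fcomp L R) (fid C)),
    (forall X : D, eps (L X) ∘ fmap L (eta X) = idc (L X)) /\
    (forall Y : C, fmap R (eps Y) ∘ eta (R Y) = idc (R Y)).

Definition is_pullback (C : category) (P A B D : C) (p1 : hom P A)
    (p2 : hom P B) (f : hom A D) (g : hom B D) : Prop :=
  f ∘ p1 = g ∘ p2 /\
  forall (Q : C) (q1 : hom Q A) (q2 : hom Q B), f ∘ q1 = g ∘ q2 ->
    exists! u : hom Q P, p1 ∘ u = q1 /\ p2 ∘ u = q2.

Definition cartesian (C D : category) (F G : functor C D) (a : nattrans F G) :=
  forall (X Y : C) (f : hom X Y),
    is_pullback (a X) (fmap F f) (fmap G f) (a Y).

Definition is_coproduct (C : category) (I : Small) (Y : I -> C) (Z : C)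
    (inj : forall i, hom (Y i) Z) : Prop :=
  forall (W : C) (g : forall i, hom (Y i) W),
    exists! u : hom Z W, forall i, u ∘ inj i = g i.

Definition preserves_coproducts (C D : category) (F : functor C D) : Prop :=
  forall (I : Small) (Y : I -> C) (Z : C) (inj : forall i, hom (Y i) Z),
    is_coproduct inj -> is_coproduct (fun i => fmap F (inj i)).

Record slice_ob (C : category) (c : C) := SliceOb {
  sl_ob :> C;
  sl_arr : hom sl_ob c }.

Record slice_hom (C : category) (c : C) (X Y : slice_ob c) := SliceHom {
  sl_hom :> hom X Y;
  sl_homP : sl_arr Y ∘ sl_hom = sl_arr X }.

Lemma slice_hom_eq (C : category) (c : C) (X Y : slice_ob c)
    (f g : slice_hom X Y) : f = g :> hom X Y -> f = g.
Proof.
case: f g => f fP [g gP] /= fg.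
by case: _ / fg gP => gP; congr SliceHom; apply: Prop_irrelevance.
Qed.

Program Definition slice (C : category) (c : C) : category :=
  @Category (slice_ob c) (@slice_hom C c)
    (fun X => @SliceHom C c X X (idc _) _)
    (fun X Y Z g f => @SliceHom C c X Z (sl_hom g ∘ sl_hom f) _) _ _ _.
Next Obligation. by move=> *; rewrite /= cmp1. Qed.
Next Obligation. by move=> *; rewrite /= cmpA !sl_homP. Qed.
Next Obligation. by move=> *; apply: slice_hom_eq; rewrite /= cmpA. Qed.
Next Obligation. by move=> *; apply: slice_hom_eq; rewrite /= cmp1. Qed.
Next Obligation. by move=> *; apply: slice_hom_eq; rewrite /= cmp1l. Qed.

Program Definition slice_functor (C D : category) (F : functor C D) (A : C) :
    functor (slice A) (slice (F A)) :=
  @Functor (slice A) (slice (F A))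
    (fun X : slice_ob A => @SliceOb D (F A) (F X) (fmap F (sl_arr X)))
    (fun X Y f => @SliceHom D (F A) _ _ (fmap F (sl_hom f)) _) _ _.
Next Obligation. by move=> *; rewrite /= -fmapM sl_homP. Qed.
Next Obligation. by move=> *; apply: slice_hom_eq; rewrite /= fmap1. Qed.
Next Obligation. by move=> *; apply: slice_hom_eq; rewrite /= fmapM. Qed.

Definition pra (C D : category) (F : functor C D) : Prop :=
  forall A : C, has_left_adjoint (slice_functor F A).

Program Definition power (C : category) (k : nat) : category :=
  @Category ('I_k -> C) (fun X Y => forall i, hom (X i) (Y i))
    (fun X i => idc (X i)) (fun X Y Z g f i => g i ∘ f i) _ _ _.
Next Obligation. by move=> *; apply: functional_extensionality_dep => i; rewrite cmpA. Qed.
Next Obligation. by move=> *; apply: functional_extensionality_dep => i; rewrite cmp1. Qed.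
Next Obligation. by move=> *; apply: functional_extensionality_dep => i; rewrite cmp1l. Qed.

(* [plug X i] is the functor Y |-> (X_1, .., Y, .., X_k), with Y in position i. *)
Definition plug_ob (C : category) (k : nat) (X : power C k) (i : 'I_k) (Y : C) :
    power C k :=
  fun i' => if i' == i then Y else X i'.

Definition plug_hom (C : category) (k : nat) (X : power C k) (i : 'I_k) (Y Y' : C)
    (f : hom Y Y') : hom (plug_ob X i Y) (plug_ob X i Y') :=
  fun i' =>
    match i' == i as b
      return hom (if b then Y else X i') (if b then Y' else X i') with
    | true => f
    | false => idc (X i')
    end.

Program Definition plug (C : category) (k : nat) (X : power C k) (i : 'I_k) :
    functor C (power C k) :=
  @Functor C (power C k) (plug_ob X i) (@plug_hom C k X i) _ _.
Next Obligation.
move=> C k X i Y; apply: functional_extensionality_dep => i'.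
by rewrite /= /plug_hom /plug_ob; case: (i' == i).
Qed.
Next Obligation.
move=> C k X i Y Y' Y'' g f; apply: functional_extensionality_dep => i'.
by rewrite /= /plug_hom /plug_ob; case: (i' == i); rewrite ?cmp1.
Qed.

Definition preserves_coproducts_each (C D : category) (k : nat)
    (F : functor (power C k) D) : Prop :=
  forall (X : power C k) (i : 'I_k), preserves_coproducts (fcomp F (plug X i)).

Record globset := GlobSet {
  cell :> nat -> Small;
  src : forall j, cell j.+1 -> cell j;
  tgt : forall j, cell j.+1 -> cell j;
  src_glob : forall j (x : cell j.+2), src (src x) = src (tgt x);
  tgt_glob : forall j (x : cell j.+2), tgt (src x) = tgt (tgt x) }.

Arguments src {g j} x.
Arguments tgt {g j} x.

Record gmap (X Y : globset) : Small := GMap {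
  gm :> forall j, X j -> Y j;
  gm_src : forall j (x : X j.+1), src (gm x) = gm (src x);
  gm_tgt : forall j (x : X j.+1), tgt (gm x) = gm (tgt x) }.

Arguments gm {X Y} g {j} x : rename.

Lemma gmap_eq (X Y : globset) (f g : gmap X Y) :
  (forall j (x : X j), gm f x = gm g x) -> f = g.
Proof.
case: f g => f fs ft [g gs gt] /= fg.
have {}fg : f = g.
  apply: functional_extensionality_dep => j.
  by apply: functional_extensionality_dep => x; apply: fg.
case: _ / fg gs gt => gs gt; congr GMap; exact: Prop_irrelevance.
Qed.

Program Definition gid (X : globset) : gmap X X := @GMap X X (fun j x => x) _ _.

Program Definition gcomp (X Y Z : globset) (g : gmap Y Z) (f : gmap X Y) :
    gmap X Z :=
  @GMap X Z (fun j x => gm g (gm f x)) _ _.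
Next Obligation. by move=> *; rewrite /= !gm_src. Qed.
Next Obligation. by move=> *; rewrite /= !gm_tgt. Qed.

(* An m-globular set is encoded as a globular set without cells of dimension
   greater than m; maps of m-globular sets are then maps of globular sets. *)
Record mglobset (m : nat) := MGlobSet {
  gset :> globset;
  gset_trunc : forall j, m < j -> gset j -> False }.

Program Definition GSet (m : nat) : category :=
  @Category (mglobset m) (fun X Y => gmap X Y) (fun X => gid X)
    (fun X Y Z g f => gcomp g f) _ _ _.
Next Obligation. by move=> *; apply: gmap_eq. Qed.
Next Obligation. by move=> *; apply: gmap_eq. Qed.
Next Obligation. by move=> *; apply: gmap_eq. Qed.

Fixpoint src0 (X : globset) (j : nat) : X j -> X 0 :=
  match j with 0 => fun x => x | j'.+1 => fun x => src0 (src x) end.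

Fixpoint tgt0 (X : globset) (j : nat) : X j -> X 0 :=
  match j with 0 => fun x => x | j'.+1 => fun x => tgt0 (tgt x) end.

Lemma src0_tgt (X : globset) j (x : X j.+2) : src0 (tgt x) = src0 (src x).
Proof. by rewrite /= src_glob. Qed.

Lemma tgt0_src (X : globset) j (x : X j.+2) : tgt0 (src x) = tgt0 (tgt x).
Proof. by rewrite /= tgt_glob. Qed.

Lemma gm_src0 (X Y : globset) (f : gmap X Y) j (x : X j) :
  src0 (gm f x) = gm f (src0 x).
Proof. by elim: j x => //= j IH x; rewrite gm_src IH. Qed.

Lemma gm_tgt0 (X Y : globset) (f : gmap X Y) j (x : X j) :
  tgt0 (gm f x) = gm f (tgt0 x).
Proof. by elim: j x => //= j IH x; rewrite gm_tgt IH. Qed.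

Record hcell (X : globset) (a b : X 0) (j : nat) : Small := HCell {
  hc :> X j.+1;
  hc_src0 : src0 hc = a;
  hc_tgt0 : tgt0 hc = b }.

Lemma hcell_eq (X : globset) (a b : X 0) j (x y : hcell a b j) :
  hc x = hc y -> x = y.
Proof.
case: x y => x xs xt [y ys yt] /= xy.
case: _ / xy ys yt => ys yt; congr HCell; exact: Prop_irrelevance.
Qed.

Lemma hom_src_src0 (X : globset) (a b : X 0) j (x : hcell a b j.+1) :
  src0 (src (hc x)) = a.
Proof. exact: (hc_src0 x). Qed.
Lemma hom_src_tgt0 (X : globset) (a b : X 0) j (x : hcell a b j.+1) :
  tgt0 (src (hc x)) = b.
Proof. by rewrite tgt0_src; apply: (hc_tgt0 x). Qed.
Lemma hom_tgt_src0 (X : globset) (a b : X 0) j (x : hcell a b j.+1) :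
  src0 (tgt (hc x)) = a.
Proof. by rewrite src0_tgt; apply: (hc_src0 x). Qed.
Lemma hom_tgt_tgt0 (X : globset) (a b : X 0) j (x : hcell a b j.+1) :
  tgt0 (tgt (hc x)) = b.
Proof. exact: (hc_tgt0 x). Qed.

Program Definition ghom (X : globset) (a b : X 0) : globset :=
  @GlobSet (hcell a b)
    (fun j x => HCell (hom_src_src0 x) (hom_src_tgt0 x))
    (fun j x => HCell (hom_tgt_src0 x) (hom_tgt_tgt0 x)) _ _.
Next Obligation. by move=> *; apply: hcell_eq; rewrite /= src_glob. Qed.
Next Obligation. by move=> *; apply: hcell_eq; rewrite /= tgt_glob. Qed.

Program Definition mhom (n : nat) (X : mglobset n.+1) (a b : X 0) : mglobset n :=
  @MGlobSet n (ghom a b) _.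
Next Obligation. by move=> n X a b j nj x; apply: (@gset_trunc _ X j.+1 nj (hc x)). Qed.

Lemma ghom_map_src0 (X Y : globset) (f : gmap X Y) (a b : X 0) (a' b' : Y 0)
    (fa : gm f a = a') j (x : hcell a b j) : src0 (gm f (hc x)) = a'.
Proof. by rewrite gm_src0 hc_src0. Qed.
Lemma ghom_map_tgt0 (X Y : globset) (f : gmap X Y) (a b : X 0) (a' b' : Y 0)
    (fb : gm f b = b') j (x : hcell a b j) : tgt0 (gm f (hc x)) = b'.
Proof. by rewrite gm_tgt0 hc_tgt0. Qed.

(* The map X(a, b) -> Y(a', b') induced by f : X -> Y with f a = a', f b = b'. *)
Program Definition ghom_map (X Y : globset) (f : gmap X Y) (a b : X 0)
    (a' b' : Y 0) (fa : gm f a = a') (fb : gm f b = b') :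
    gmap (ghom a b) (ghom a' b') :=
  @GMap (ghom a b) (ghom a' b')
    (fun j x => HCell (ghom_map_src0 b' fa x) (ghom_map_tgt0 a' fb x)) _ _.
Next Obligation. by move=> *; apply: hcell_eq; rewrite /= gm_src. Qed.
Next Obligation. by move=> *; apply: hcell_eq; rewrite /= gm_tgt. Qed.

(* Sequences are indexed from 0: the i-th entry (i < k) is the hom (i, i.+1). *)
Definition seq_cell (k : nat) (X : 'I_k -> globset) (j : nat) : Small :=
  match j with 0 => 'I_k.+1 | j'.+1 => {i : 'I_k & X i j'} end.

Definition seq_src (k : nat) (X : 'I_k -> globset) (j : nat) :
    seq_cell X j.+1 -> seq_cell X j :=
  match j with
  | 0 => fun x => widen_ord (leqnSn k) (tag x)
  | j'.+1 => fun x => existT _ (tag x) (src (tagged x))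
  end.

Definition seq_tgt (k : nat) (X : 'I_k -> globset) (j : nat) :
    seq_cell X j.+1 -> seq_cell X j :=
  match j with
  | 0 => fun x => lift ord0 (tag x)
  | j'.+1 => fun x => existT _ (tag x) (tgt (tagged x))
  end.

Program Definition gseq (k : nat) (X : 'I_k -> globset) : globset :=
  @GlobSet (seq_cell X) (@seq_src k X) (@seq_tgt k X) _ _.
Next Obligation. by move=> k X [|j] [i x] //=; rewrite src_glob. Qed.
Next Obligation. by move=> k X [|j] [i x] //=; rewrite tgt_glob. Qed.

Definition gseq_map_fun (k : nat) (X Y : 'I_k -> globset)
    (f : forall i, gmap (X i) (Y i)) (j : nat) : seq_cell X j -> seq_cell Y j :=
  match j with
  | 0 => fun x => x
  | j'.+1 => fun x => existT _ (tag x) (gm (f (tag x)) (tagged x))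
  end.

Program Definition gseq_map (k : nat) (X Y : 'I_k -> globset)
    (f : forall i, gmap (X i) (Y i)) : gmap (gseq X) (gseq Y) :=
  @GMap (gseq X) (gseq Y) (gseq_map_fun f) _ _.
Next Obligation. by move=> k X Y f [|j] [i x] //=; rewrite gm_src. Qed.
Next Obligation. by move=> k X Y f [|j] [i x] //=; rewrite gm_tgt. Qed.

Program Definition mseq (n k : nat) (X : power (GSet n) k) : mglobset n.+1 :=
  @MGlobSet n.+1 (gseq (fun i => gset (X i))) _.
Next Obligation. by move=> n k X [|j] //= nj [i x]; apply: (@gset_trunc n (X i) j nj x). Qed.

Program Definition seqF (n k : nat) : functor (power (GSet n) k) (GSet n.+1) :=
  @Functor (power (GSet n) k) (GSet n.+1) (@mseq n k)
    (fun X Y f => gseq_map f) _ _.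
Next Obligation. by move=> n k X; apply: gmap_eq => -[|j] //= [i x]. Qed.
Next Obligation. by move=> n k X Y Z g f; apply: gmap_eq => -[|j] //= [i x]. Qed.

(* A finite sequence of trees is a length k with a k-tuple 'I_k -> Tr j. *)
Fixpoint Tr (j : nat) : Small :=
  match j with 0 => unit | j'.+1 => {k : nat & 'I_k -> Tr j'} end.

Definition point : globset :=
  @GlobSet (fun j => if j is 0 then unit else Empty_set : Small)
    (fun j x => match x with end) (fun j x => match x with end)
    (fun j x => match x with end) (fun j x => match x with end).

Definition point_map_fun (Y : globset) (y : Y 0) (j : nat) : point j -> Y j :=
  match j with 0 => fun _ => y | j'.+1 => fun x => match x with end end.

Definition point_map (Y : globset) (y : Y 0) : gmap point Y :=
  @GMap point Y (point_map_fun y)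
    (fun j x => match x with end) (fun j x => match x with end).

Fixpoint tree (j : nat) : Tr j -> globset :=
  match j with
  | 0 => fun _ => point
  | j'.+1 => fun p => gseq (fun i => tree (projT2 p i))
  end.

Fixpoint bd (j : nat) : Tr j.+1 -> Tr j :=
  match j with
  | 0 => fun _ => tt
  | j'.+1 => fun p => existT _ (projT1 p) (fun i => bd (projT2 p i))
  end.

Fixpoint sigma (j : nat) : forall p : Tr j.+1, gmap (tree (bd p)) (tree p) :=
  match j with
  | 0 => fun p => @point_map (tree p) (ord0 : 'I_(projT1 p).+1)
  | j'.+1 => fun p => gseq_map (fun i => sigma (projT2 p i))
  end.

Fixpoint tau (j : nat) : forall p : Tr j.+1, gmap (tree (bd p)) (tree p) :=
  match j with
  | 0 => fun p => @point_map (tree p) (ord_max : 'I_(projT1 p).+1)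
  | j'.+1 => fun p => gseq_map (fun i => tau (projT2 p i))
  end.

Lemma sigma_glob j (p : Tr j.+2) :
  gcomp (sigma p) (sigma (bd p)) = gcomp (tau p) (sigma (bd p)).
Proof.
elim: j p => [|j IH] p; apply: gmap_eq => -[|i] //= [a x] //=.
by congr existT; apply: (congr1 (fun f => gm f x) (IH (projT2 p a))).
Qed.

Lemma tau_glob j (p : Tr j.+2) :
  gcomp (sigma p) (tau (bd p)) = gcomp (tau p) (tau (bd p)).
Proof.
elim: j p => [|j IH] p; apply: gmap_eq => -[|i] //= [a x] //=.
by congr existT; apply: (congr1 (fun f => gm f x) (IH (projT2 p a))).
Qed.

Section EndofunctorT.
Variable m : nat.

Record tcell (X : globset) (j : nat) : Small := TCell {
  tc_dim : j <= m;
  tc_shape : Tr j;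
  tc_map : gmap (tree tc_shape) X }.

Lemma tcell_eq (X : globset) j (h h' : j <= m) (p : Tr j)
    (f f' : gmap (tree p) X) : f = f' -> TCell h f = TCell h' f'.
Proof. by move=> ->; rewrite (bool_irrelevance h h'). Qed.

Definition tsrc (X : globset) j (c : tcell X j.+1) : tcell X j :=
  TCell (ltnW (tc_dim c)) (gcomp (tc_map c) (sigma (tc_shape c))).

Definition ttgt (X : globset) j (c : tcell X j.+1) : tcell X j :=
  TCell (ltnW (tc_dim c)) (gcomp (tc_map c) (tau (tc_shape c))).

Lemma tsrc_glob (X : globset) j (c : tcell X j.+2) :
  tsrc (tsrc c) = tsrc (ttgt c).
Proof.
apply: tcell_eq; apply: gmap_eq => i x /=; congr (gm (tc_map c) _).
exact: (congr1 (fun f => gm f x) (sigma_glob (tc_shape c))).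
Qed.

Lemma ttgt_glob (X : globset) j (c : tcell X j.+2) :
  ttgt (tsrc c) = ttgt (ttgt c).
Proof.
apply: tcell_eq; apply: gmap_eq => i x /=; congr (gm (tc_map c) _).
exact: (congr1 (fun f => gm f x) (tau_glob (tc_shape c))).
Qed.

Definition tset (X : globset) : globset :=
  @GlobSet (tcell X) (@tsrc X) (@ttgt X) (@tsrc_glob X) (@ttgt_glob X).

Program Definition Tob (X : mglobset m) : mglobset m := @MGlobSet m (tset X) _.
Next Obligation. by move=> X j mj [jm _ _]; rewrite leqNgt mj in jm. Qed.

Program Definition Tmap (X Y : globset) (h : gmap X Y) : gmap (tset X) (tset Y) :=
  @GMap (tset X) (tset Y)
    (fun j c => TCell (tc_dim c) (gcomp h (tc_map c))) _ _.
Next Obligation. by move=> *; apply: tcell_eq; apply: gmap_eq. Qed.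
Next Obligation. by move=> *; apply: tcell_eq; apply: gmap_eq. Qed.

Program Definition T : functor (GSet m) (GSet m) :=
  @Functor (GSet m) (GSet m) Tob (fun X Y h => Tmap h) _ _.
Next Obligation.
by move=> X; apply: gmap_eq => j [h p f] /=; apply: tcell_eq; apply: gmap_eq.
Qed.
Next Obligation.
by move=> *; apply: gmap_eq => j [h p f] /=; apply: tcell_eq; apply: gmap_eq.
Qed.

(* The identification X_0 = {T X}_0. *)
Definition vtx (X : globset) (x : X 0) : tset X 0 :=
  @TCell X 0 (leq0n m) tt (point_map x).

End EndofunctorT.

Arguments vtx m {X} x.

Lemma Tmap_vtx m (X Y : globset) (h : gmap X Y) (x : X 0) :
  gm (Tmap m h) (vtx m x) = vtx m (gm h x).
Proof. by apply: tcell_eq; apply: gmap_eq => -[|j] []. Qed.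

Lemma vtx_inj m (X : globset) : injective (@vtx m X).
Proof.
pose v (c : tset m X 0) : X 0 := @gm point X (tc_map c) 0 tt.
exact: (@can_inj _ _ _ v).
Qed.

Definition cast (A B : Small) (e : A = B) (x : A) : B :=
  match e in _ = B' return B' with erefl => x end.

(* [nc_dim0] and [nc_id0] say that the components of the augmentation are
   identities in dimension 0, {A X}_0 = X_0 = {T X}_0. *)
Record ncoll (n : nat) := NColl {
  nc_fun :> functor (GSet n.+1) (GSet n.+1);
  nc_aug : nattrans nc_fun (T n.+1);
  nc_cart : cartesian nc_aug;
  nc_dim0 : forall X : mglobset n.+1, X 0 = nc_fun X 0 :> Small;
  nc_id0 : forall (X : mglobset n.+1) (x : X 0),
    gm (nc_aug X) (cast (nc_dim0 X) x) = vtx n.+1 x }.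

Record ncoll_hom (n : nat) (A B : ncoll n) := NCollHom {
  nc_hom :> nattrans A B;
  nc_homP : forall X, nc_aug B X ∘ nc_hom X = nc_aug A X }.

Lemma ncoll_hom_eq n (A B : ncoll n) (f g : ncoll_hom A B) :
  (forall X, f X = g X) -> f = g.
Proof.
case: f g => f fP [g gP] /= fg0.
have fg : f = g by exact: (@nattrans_eq _ _ _ _ f g fg0).
by case: _ / fg gP => gP; congr NCollHom; apply: Prop_irrelevance.
Qed.

Program Definition NCOLL (n : nat) : category :=
  @Category (ncoll n) (@ncoll_hom n)
    (fun A => @NCollHom n A A (nt_id A) _)
    (fun A B C g f => @NCollHom n A C (nt_comp g f) _) _ _ _.
Next Obligation. by move=> *; apply: cmp1. Qed.
Next Obligation.
move=> n A B C g f X; apply: (etrans (cmpA (nc_aug C X) (g X) (f X))).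
by rewrite !nc_homP.
Qed.
Next Obligation. by move=> *; apply: ncoll_hom_eq => X; apply: cmpA. Qed.
Next Obligation. by move=> *; apply: ncoll_hom_eq => X; apply: cmp1. Qed.
Next Obligation. by move=> *; apply: ncoll_hom_eq => X; apply: cmp1l. Qed.

(* The 0-cell x of X, regarded as a 0-cell of A X. *)
Definition nc_pt n (A : ncoll n) (X : mglobset n.+1) (x : X 0) : A X 0 :=
  cast (nc_dim0 A X) x.

Lemma nc_ptP n (A : ncoll n) (X : mglobset n.+1) (y : A X 0) :
  {x : X 0 | y = nc_pt A x}.
Proof.
exists (cast (esym (nc_dim0 A X)) y).
by rewrite /nc_pt; case: _ / (nc_dim0 A X) y.
Qed.

Lemma nc_aug0_inj n (A : ncoll n) (X : mglobset n.+1) (y y' : A X 0) :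
  gm (nc_aug A X) y = gm (nc_aug A X) y' -> y = y'.
Proof.
case: (nc_ptP y) => x ->; case: (nc_ptP y') => x' ->.
by rewrite !nc_id0 => /vtx_inj ->.
Qed.

Lemma nc_pt_map n (A : ncoll n) (X Y : mglobset n.+1) (h : gmap X Y) (x : X 0) :
  gm (@fmap _ _ A X Y h) (nc_pt A x) = nc_pt A (gm h x).
Proof.
apply: nc_aug0_inj; rewrite nc_id0 -Tmap_vtx -(nc_id0 A x).
exact: (esym (congr1 (fun f => gm f (nc_pt A x)) (@ntP _ _ _ _ (nc_aug A) X Y h))).
Qed.

Lemma nc_pt_hom n (A B : ncoll n) (f : ncoll_hom A B) (X : mglobset n.+1) (x : X 0) :
  gm (f X) (nc_pt A x) = nc_pt B x.
Proof.
apply: nc_aug0_inj; rewrite nc_id0 -(nc_id0 A x).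
exact: (congr1 (fun f => gm f (nc_pt A x)) (nc_homP f X)).
Qed.

Definition is_pradist (n : nat)
    (E : forall k, functor (power (GSet n) k) (GSet n)) : Prop :=
  forall k, pra (E k) /\ preserves_coproducts_each (E k).

Record pradist (n : nat) := PraDist {
  pd_fun :> forall k, functor (power (GSet n) k) (GSet n);
  pd_ax : is_pradist pd_fun }.

Record pradist_hom (n : nat) (E E' : pradist n) := PraDistHom {
  pd_hom :> forall k, nattrans (E k) (E' k);
  pd_cart : forall k, cartesian (pd_hom k) }.

Lemma pradist_hom_eq n (E E' : pradist n) (f g : pradist_hom E E') :
  (forall k X, f k X = g k X) -> f = g.
Proof.
case: f g => f fP [g gP] /= fg0.
have fg : f = g.
  by apply: functional_extensionality_dep => k; apply: nattrans_eq; apply: fg0.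
by case: _ / fg gP => gP; congr PraDistHom; apply: Prop_irrelevance.
Qed.

Lemma cartesian_id (C D : category) (F : functor C D) : cartesian (nt_id F).
Proof.
move=> X Y f; split=> [|Q q1 q2 q]; first by rewrite /= cmp1 cmp1l.
exists q1; split; first by rewrite /= cmp1l q /= cmp1l.
by move=> u [<- _]; rewrite /= cmp1l.
Qed.

Lemma cartesian_comp (C D : category) (F G H : functor C D)
    (b : nattrans G H) (a : nattrans F G) :
  cartesian b -> cartesian a -> cartesian (nt_comp b a).
Proof.
move=> bP aP X Y f; split=> [|Q q1 q2 q]; first exact: ntP.
case: (bP X Y f) => _ /(_ Q q1 (a Y ∘ q2)); rewrite cmpA => /(_ q).
move=> [v [[v1 v2] vU]].
case: (aP X Y f) => _ /(_ Q v q2 v2) [u [[u1 u2] uU]].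
exists u; split; first by rewrite /= -cmpA u1.
move=> u' [u'1 u'2]; apply: uU; split=> //; apply/esym/vU; split.
  by rewrite -u'1 /= cmpA.
by rewrite cmpA ntP -cmpA u'2.
Qed.

Program Definition PRADIST (n : nat) : category :=
  @Category (pradist n) (@pradist_hom n)
    (fun E => @PraDistHom n E E (fun k => nt_id (E k)) _)
    (fun E E' E'' g f => @PraDistHom n E E'' (fun k => nt_comp (g k) (f k)) _)
    _ _ _.
Next Obligation. by move=> n E k; apply: cartesian_id. Qed.
Next Obligation. by move=> n E E' E'' g f k; apply: cartesian_comp; apply: pd_cart. Qed.
Next Obligation. by move=> *; apply: pradist_hom_eq => k X; apply: cmpA. Qed.
Next Obligation. by move=> *; apply: pradist_hom_eq => k X; apply: cmp1. Qed.
Next Obligation. by move=> *; apply: pradist_hom_eq => k X; apply: cmp1l. Qed.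

(* Cells of the product in n-globular sets; the bound on j matters for k = 0. *)
Record pcell (n k : nat) (X : 'I_k -> globset) (j : nat) : Small := PCell {
  pc_dim : j <= n;
  pc_val : forall i, X i j }.

Lemma pcell_eq n k (X : 'I_k -> globset) j (x y : pcell n X j) :
  (forall i, pc_val x i = pc_val y i) -> x = y.
Proof.
case: x y => h x [h' y] /= xy.
have -> : x = y by apply: functional_extensionality_dep.
by rewrite (bool_irrelevance h h').
Qed.

Program Definition gprod (n k : nat) (X : 'I_k -> globset) : globset :=
  @GlobSet (pcell n X)
    (fun j x => PCell (ltnW (pc_dim x)) (fun i => src (pc_val x i)))
    (fun j x => PCell (ltnW (pc_dim x)) (fun i => tgt (pc_val x i))) _ _.
Next Obligation. by move=> *; apply: pcell_eq => i /=; rewrite src_glob. Qed.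
Next Obligation. by move=> *; apply: pcell_eq => i /=; rewrite tgt_glob. Qed.

Program Definition mprod (n k : nat) (X : power (GSet n) k) : mglobset n :=
  @MGlobSet n (gprod n (fun i => gset (X i))) _.
Next Obligation. by move=> n k X j nj [jn _]; rewrite leqNgt nj in jn. Qed.

Program Definition gprod_map (n k : nat) (X Y : 'I_k -> globset)
    (f : forall i, gmap (X i) (Y i)) : gmap (gprod n X) (gprod n Y) :=
  @GMap (gprod n X) (gprod n Y)
    (fun j x => PCell (pc_dim x) (fun i => gm (f i) (pc_val x i))) _ _.
Next Obligation. by move=> *; apply: pcell_eq => i /=; rewrite gm_src. Qed.
Next Obligation. by move=> *; apply: pcell_eq => i /=; rewrite gm_tgt. Qed.

Program Definition Ttimes (n k : nat) : functor (power (GSet n) k) (GSet n) :=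
  @Functor (power (GSet n) k) (GSet n)
    (fun X => mprod (fun i => T n (X i)))
    (fun X Y f => gprod_map n (fun i => fmap (T n) (f i))) _ _.
Next Obligation.
move=> n k X; apply: gmap_eq => j x; apply: pcell_eq => i /=.
by case: (pc_val x i) => h p f0; apply: tcell_eq; apply: gmap_eq.
Qed.
Next Obligation.
move=> n k X Y Z g f; apply: gmap_eq => j x; apply: pcell_eq => i /=.
by case: (pc_val x i) => h p f0; apply: tcell_eq; apply: gmap_eq.
Qed.

Definition tree_pt (j : nat) : forall p : Tr j, tree p 0 :=
  match j with 0 => fun _ => tt | j'.+1 => fun p => ord0 : 'I_(projT1 p).+1 end.

Lemma gseq_map0 l k (P : 'I_l -> globset) (Y : 'I_k -> globset)
    (F : gmap (gseq P) (gseq Y)) :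
  (forall i, P i 0) -> @gm (gseq P) (gseq Y) F 0 (ord0 : 'I_l.+1) = (ord0 : 'I_k.+1) ->
  forall i : 'I_l.+1, (@gm (gseq P) (gseq Y) F 0 i : 'I_k.+1) = i :> nat.
Proof.
move=> pt F0 [m ml]; elim: m ml => [|m IH] ml.
  by rewrite (_ : Ordinal ml = ord0) ?F0 //; apply: val_inj.
have ml' : m < l by [].
pose x : gseq P 1 := existT _ (Ordinal ml') (pt (Ordinal ml')).
have := gm_tgt F x; have := gm_src F x.
case: (gm F x) => i y /= Fs Ft.
have := IH (ltnW ml); rewrite (_ : Ordinal (ltnW ml) = widen_ord (leqnSn l) (Ordinal ml')); last exact: val_inj.
rewrite -Fs /= => im.
rewrite (_ : Ordinal ml = lift ord0 (Ordinal ml')); last exact: val_inj.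
by rewrite -Ft /= /bump /= im.
Qed.

Lemma gseq_map_tag k (P Y : 'I_k -> globset) (F : gmap (gseq P) (gseq Y)) :
  (forall i : 'I_k.+1, (@gm (gseq P) (gseq Y) F 0 i : 'I_k.+1) = i :> nat) ->
  forall j i (x : P i j), tag (@gm (gseq P) (gseq Y) F j.+1 (existT _ i x)) = i.
Proof.
move=> F0; elim=> [|j IH] i x.
  have := gm_src F (existT _ i x : gseq P 1).
  case: (gm F _) => i' y /= /(congr1 (@nat_of_ord _)) /= ii'.
  by apply: val_inj; rewrite /= ii' F0.
have := gm_src F (existT _ i x : gseq P j.+2).
have := IH i (src x); rewrite /=.
by case: (@gm _ _ F j.+2 _) => i' y /= H E; rewrite -E in H.
Qed.

Lemma existT_inj (I : Type) (F : I -> Type) i (x y : F i) :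
  existT F i x = existT F i y -> x = y.
Proof.
move=> e; have := projT2_eq e.
by rewrite (Prop_irrelevance (projT1_eq e) erefl).
Qed.

Lemma gseq_map_full k (P Y : 'I_k -> globset) (F : gmap (gseq P) (gseq Y)) :
  (forall i : 'I_k.+1, (@gm (gseq P) (gseq Y) F 0 i : 'I_k.+1) = i :> nat) ->
  exists f : forall i, gmap (P i) (Y i), F = gseq_map f.
Proof.
move=> F0.
have F1 i j (x : P i j) : {y : Y i j | @gm (gseq P) (gseq Y) F j.+1 (existT _ i x) = existT _ i y}.
  have := gseq_map_tag F0 x; case: (gm F _) => i' y /= ii'.
  by case: _ / ii'; exists y.
pose f i j x := sval (F1 i j x).
have fP i j x : @gm (gseq P) (gseq Y) F j.+1 (existT _ i x) = existT _ i (f i j x).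
  exact: svalP (F1 i j x).
have fs i j (x : P i j.+1) : src (f i j.+1 x) = f i j (src x).
  have := gm_src F (existT _ i x : gseq P j.+2); rewrite fP /= fP.
  exact: existT_inj.
have ft i j (x : P i j.+1) : tgt (f i j.+1 x) = f i j (tgt x).
  have := gm_tgt F (existT _ i x : gseq P j.+2); rewrite fP /= fP.
  exact: existT_inj.
exists (fun i => @GMap (P i) (Y i) (f i) (fs i) (ft i)).
apply: gmap_eq => -[|j] /=; first by move=> i; apply: val_inj; apply: F0.
by move=> [i x]; rewrite fP.
Qed.

Lemma tree_gseq_full j l k (p : 'I_l -> Tr j) (Y : 'I_k -> globset)
    (F : gmap (tree (existT _ l p : Tr j.+1)) (gseq Y)) :
  @gm (gseq _) (gseq Y) F 0 (ord0 : 'I_l.+1) = (ord0 : 'I_k.+1) ->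
  @gm (gseq _) (gseq Y) F 0 (ord_max : 'I_l.+1) = (ord_max : 'I_k.+1) ->
  exists (q : 'I_k -> Tr j) (f : forall i, gmap (tree (q i)) (Y i)),
    existT (fun P : Tr j.+1 => gmap (tree P) (gseq Y)) (existT _ l p) F
    = existT _ (existT _ k q) (gseq_map f).
Proof.
move=> Fs Ft; have F0 := gseq_map0 (fun i => tree_pt (p i)) Fs.
have lk : l = k by rewrite -[LHS](F0 ord_max) Ft.
subst k; exists p; have [f fF] := gseq_map_full F0.
by exists f; rewrite -fF.
Qed.

Section Identification.
Variables (n k : nat) (X : power (GSet n) k).

Definition iota_cell (j : nat) (c : mprod (fun i => T n (X i)) j) :
    T n.+1 (mseq X) j.+1 :=
  @TCell n.+1 (mseq X) j.+1 (pc_dim c)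
    (existT _ k (fun i => tc_shape (pc_val c i)))
    (gseq_map (fun i => tc_map (pc_val c i))).

Lemma Tsrc0 (Y : mglobset n.+1) j (c : T n.+1 Y j.+1) :
  src0 c = vtx n.+1 (@gm (tree (tc_shape c)) Y (tc_map c) 0
                      (ord0 : 'I_(projT1 (tc_shape c)).+1)).
Proof.
elim: j c => [|j IH] c; last first.
  by move: (IH (src c)).
by apply: tcell_eq; apply: gmap_eq => -[|i] [].
Qed.

Lemma Ttgt0 (Y : mglobset n.+1) j (c : T n.+1 Y j.+1) :
  tgt0 c = vtx n.+1 (@gm (tree (tc_shape c)) Y (tc_map c) 0
                      (ord_max : 'I_(projT1 (tc_shape c)).+1)).
Proof.
elim: j c => [|j IH] c; last first.
  by move: (IH (tgt c)).
by apply: tcell_eq; apply: gmap_eq => -[|i] [].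
Qed.

Definition Tseq_hom : mglobset n :=
  @mhom n (T n.+1 (mseq X)) (vtx n.+1 (ord0 : mseq X 0))
    (vtx n.+1 (ord_max : mseq X 0)).

Lemma iota_cell_inj j (h h' : j <= n) (p p' : 'I_k -> Tr j)
    (f : forall i, gmap (tree (p i)) (X i)) (f' : forall i, gmap (tree (p' i)) (X i)) :
  @TCell n.+1 (mseq X) j.+1 h (existT _ k p) (gseq_map f) =
  @TCell n.+1 (mseq X) j.+1 h' (existT _ k p') (gseq_map f') ->
  forall i, TCell h (f i) = TCell h (f' i).
Proof.
move=> e i.
have {}e : existT (fun P : Tr j.+1 => gmap (tree P) (mseq X)) (existT _ k p) (gseq_map f)
         = existT _ (existT _ k p') (gseq_map f').
  exact: (congr1 (fun c => existT (fun P : Tr j.+1 => gmap (tree P) (mseq X))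
                                 (tc_shape c) (tc_map c)) e).
have pp' : p = p'.
  exact: (@existT_inj nat (fun k => 'I_k -> Tr j) k _ _ (congr1 (@projT1 _ _) e)).
subst p'; have {}e := existT_inj e.
apply: tcell_eq; apply: gmap_eq => a x.
exact: (existT_inj (congr1 (fun F : gmap (gseq _) (gseq _) =>
  @gm _ _ F a.+1 (existT _ i x)) e)).
Qed.

Definition iota_hcell j (c : mprod (fun i => T n (X i)) j) : Tseq_hom j :=
  @HCell (T n.+1 (mseq X)) (vtx n.+1 (ord0 : mseq X 0))
    (vtx n.+1 (ord_max : mseq X 0)) j (iota_cell c)
    (Tsrc0 (iota_cell c)) (Ttgt0 (iota_cell c)).

Lemma iota_inj j : injective (@iota_hcell j).
Proof.
move=> [h c] [h' c'] /(congr1 (@hc _ _ _ _)) /= e.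
apply: pcell_eq => i /=.
have E (d : tset n (X i) j) : d = TCell h (tc_map d).
  by case: d => *; apply: tcell_eq.
by rewrite (E (c i)) (E (c' i)); apply: iota_cell_inj e i.
Qed.

Lemma iota_surj j (c : Tseq_hom j) : exists d, iota_hcell d = c.
Proof.
case: c => [c s0 t0].
have Fs := vtx_inj (etrans (esym (Tsrc0 c)) s0).
have Ft := vtx_inj (etrans (esym (Ttgt0 c)) t0).
case: c s0 t0 Fs Ft => h [l p] F /= s0 t0 Fs Ft.
have [q [f e]] := tree_gseq_full Fs Ft.
exists (@PCell n k (fun i => tset n (X i)) j h (fun i => @TCell n (X i) j h (q i) (f i))).
apply: hcell_eq; rewrite /iota_hcell /iota_cell /=.
pose G (u : {P : Tr j.+1 & gmap (tree P) (mseq X)}) : T n.+1 (mseq X) j.+1 :=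
  @TCell n.+1 (mseq X) j.+1 h (projT1 u) (projT2 u).
exact: (esym (congr1 G e)).
Qed.

Lemma iota_src j (c : mprod (fun i => T n (X i)) j.+1) :
  src (iota_hcell c) = iota_hcell (src c).
Proof. by apply: hcell_eq; apply: tcell_eq; apply: gmap_eq => -[|a] //= []. Qed.

Lemma iota_tgt j (c : mprod (fun i => T n (X i)) j.+1) :
  tgt (iota_hcell c) = iota_hcell (tgt c).
Proof. by apply: hcell_eq; apply: tcell_eq; apply: gmap_eq => -[|a] //= []. Qed.

(* The inverse of ((p_i, f_i))_i |-> (p, f), where p = (p_1, .., p_k) and f is
   the identity on 0-cells and f_i on homs. *)
Definition theta_cell j (c : Tseq_hom j) : mprod (fun i => T n (X i)) j :=
  sval (cid (iota_surj c)).

Lemma theta_cellK j (c : Tseq_hom j) : iota_hcell (theta_cell c) = c.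
Proof. exact: svalP (cid (iota_surj c)). Qed.

Program Definition theta : gmap Tseq_hom (mprod (fun i => T n (X i))) :=
  @GMap Tseq_hom (mprod (fun i => T n (X i))) theta_cell _ _.
Next Obligation. by move=> j c; apply: iota_inj; rewrite -iota_src !theta_cellK. Qed.
Next Obligation. by move=> j c; apply: iota_inj; rewrite -iota_tgt !theta_cellK. Qed.

End Identification.

Lemma iota_nat n k (X Y : power (GSet n) k) (f : hom X Y) j
    (c : mprod (fun i => T n (X i)) j) :
  hc (iota_hcell (gm (fmap (Ttimes n k) f) c)) =
  gm (Tmap n.+1 (fmap (seqF n k) f)) (hc (iota_hcell c)).
Proof. by apply: tcell_eq; apply: gmap_eq => -[|a] //= []. Qed.

Definition bar_ob n (A : ncoll n) k (X : power (GSet n) k) : mglobset n :=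
  @mhom n (A (mseq X)) (nc_pt A (ord0 : mseq X 0)) (nc_pt A (ord_max : mseq X 0)).

Definition bar_map n (A : ncoll n) k (X Y : power (GSet n) k) (f : hom X Y) :
    gmap (bar_ob A X) (bar_ob A Y) :=
  ghom_map (nc_pt_map A (fmap (seqF n k) f) (ord0 : mseq X 0))
           (nc_pt_map A (fmap (seqF n k) f) (ord_max : mseq X 0)).

Program Definition bar_fun n (A : ncoll n) k :
    functor (power (GSet n) k) (GSet n) :=
  @Functor (power (GSet n) k) (GSet n) (@bar_ob n A k) (@bar_map n A k) _ _.
Next Obligation.
move=> n A k X; apply: gmap_eq => j x; apply: hcell_eq.
exact: (congr1 (fun f => gm f (hc x)) (fmap1 (fcomp A (seqF n k)) X)).
Qed.
Next Obligation.
move=> n A k X Y Z g f; apply: gmap_eq => j x; apply: hcell_eq.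
exact: (congr1 (fun f => gm f (hc x)) (fmapM (fcomp A (seqF n k)) g f)).
Qed.

(* The component of the augmentation, {A(X_1, .., X_k)}(0, k) ->
   {T(X_1, .., X_k)}(0, k), followed by the identification with T^x. *)
Program Definition bar_aug n (A : ncoll n) k : nattrans (bar_fun A k) (Ttimes n k) :=
  @NatTrans (power (GSet n) k) (GSet n) (bar_fun A k) (Ttimes n k)
    (fun X => gcomp (theta X)
       (ghom_map (nc_id0 A (ord0 : mseq X 0)) (nc_id0 A (ord_max : mseq X 0)))) _.
Next Obligation.
move=> n A k X Y f; apply: gmap_eq => j x; apply: iota_inj; apply: hcell_eq.
apply: (etrans (iota_nat f _)).
apply: (etrans (congr1 (fun u => gm (Tmap n.+1 (fmap (seqF n k) f)) (hc u)) (theta_cellK _))).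
apply: (etrans _ (esym (congr1 (@hc _ _ _ _) (theta_cellK _)))).
exact: (congr1 (fun g => gm g (hc x)) (ntP (nc_aug A) (fmap (seqF n k) f))).
Qed.

Program Definition bar_nat n (A B : ncoll n) (f : ncoll_hom A B) k :
    nattrans (bar_fun A k) (bar_fun B k) :=
  @NatTrans (power (GSet n) k) (GSet n) (bar_fun A k) (bar_fun B k)
    (fun X => ghom_map (nc_pt_hom f (ord0 : mseq X 0))
                       (nc_pt_hom f (ord_max : mseq X 0))) _.
Next Obligation.
move=> n A B f k X Y g; apply: gmap_eq => j x; apply: hcell_eq.
exact: (congr1 (fun f => gm f (hc x)) (ntP f (fmap (seqF n k) g))).
Qed.

Lemma bar_nat_aug n (A B : ncoll n) (f : ncoll_hom A B) k (X : power (GSet n) k) :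
  bar_aug B k X ∘ bar_nat f k X = bar_aug A k X.
Proof.
apply: gmap_eq => j x /=; congr theta_cell; apply: hcell_eq.
exact: (congr1 (fun f => gm f (hc x)) (nc_homP f (mseq X))).
Qed.

(* All components below are determined by data defined above; these propositions
   say that they are objects and morphisms of PraDist. *)
Record bar_well_defined (n : nat) : Prop := BarWellDefined {
  wd_times : is_pradist (Ttimes n);
  wd_fun : forall A : ncoll n, is_pradist (bar_fun A);
  wd_aug : forall (A : ncoll n) k, cartesian (bar_aug A k);
  wd_nat : forall (A B : ncoll n) (f : ncoll_hom A B) k, cartesian (bar_nat f k) }.

Definition TTIMES (n : nat) (wd : bar_well_defined n) : PRADIST n :=
  PraDist (wd_times wd).

Definition bar_slice_ob (n : nat) (wd : bar_well_defined n) (A : ncoll n) :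
    slice (TTIMES wd) :=
  @SliceOb (PRADIST n) (TTIMES wd) (PraDist (wd_fun wd A))
    (@PraDistHom n (PraDist (wd_fun wd A)) (TTIMES wd) (bar_aug A) (wd_aug wd A)).

Program Definition bar_slice_hom (n : nat) (wd : bar_well_defined n)
    (A B : ncoll n) (f : ncoll_hom A B) :
    hom (bar_slice_ob wd A) (bar_slice_ob wd B) :=
  @SliceHom (PRADIST n) (TTIMES wd) (bar_slice_ob wd A) (bar_slice_ob wd B)
    (@PraDistHom n (PraDist (wd_fun wd A)) (PraDist (wd_fun wd B))
       (bar_nat f) (wd_nat wd f)) _.
Next Obligation.
by move=> n wd A B f; apply: pradist_hom_eq => k X; apply: bar_nat_aug.
Qed.

Program Definition bar (n : nat) (wd : bar_well_defined n) :
    functor (NCOLL n) (slice (TTIMES wd)) :=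
  @Functor (NCOLL n) (slice (TTIMES wd)) (bar_slice_ob wd) (@bar_slice_hom n wd) _ _.
Next Obligation.
move=> n wd A; apply: slice_hom_eq; apply: pradist_hom_eq => k X.
by apply: gmap_eq => j x; apply: hcell_eq.
Qed.
Next Obligation.
move=> n wd A B C g f; apply: slice_hom_eq; apply: pradist_hom_eq => k X.
by apply: gmap_eq => j x; apply: hcell_eq.
Qed.

(* Main.v *)
(** A cell of [T X] of positive dimension is the same thing as a sequence
    [v_0, .., v_k] of 0-cells of [X] together with a cell of
    [Ttimes (X(v_0, v_1), .., X(v_(k-1), v_k))]. Pulling this back along the
    cartesian augmentation, the hom sets of [A X] are the disjoint unions over all
    such sequences of the values of [bar A]: this makes [bar] fully faithful, and
    read as a definition it glues a cartesian [E -> Ttimes] into a collection whose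
    image is [E]. Conversely any functor with a cartesian transformation to
    [Ttimes] inherits parametric adjointness and distributivity from it, and
    [Ttimes] has them because the cells of [T X] are maps into [X] out of trees,
    which are connected. *)

From mathcomp Require Import all_boot.
From mathcomp Require Import boolp.
Require Import Defs.
Set Implicit Arguments.
Unset Strict Implicit.
Unset Printing Implicit Defensive.

#[local] Obligation Tactic := try by [].
Local Open Scope cat_scope.

(** * Categories *)

(** Parametric adjointness of [T]: a map [y : Y -> T A] gives each cell of [Y] a tree, and every [u]
    with [fmap (T m) x ∘ u = y] gives it the same tree. The generic object therefore only has to
    glue fixed trees along their boundaries. This colimit is taken as a quotient by a universally
    quantified relation rather than a generated one; the price is transport between trees that are
    only provably equal. Essential surjectivity: a priori the hom from 0 to k of the glued
    collection at (X_1, .., X_k) involves all chains of vertices from 0 to k. The augmentation turns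
    a cell over such a chain into a map from a tree, which must walk through a sequence one vertex
    at a time. So only the chain 0, 1, .., k survives, and the hom is E_k(X_1, .., X_k).
    Decompositions of cells are dependent triples (length, vertices, cell). Their equalities are
    stated between whole triples, since lengths and vertices agree only after proof. *)

Definition faithful (C D : category) (F : functor C D) : Prop :=
  forall (X Y : C) (f g : hom X Y), fmap F f = fmap F g -> f = g.

Definition full (C D : category) (F : functor C D) : Prop :=
  forall (X Y : C) (g : hom (F X) (F Y)), exists f : hom X Y, fmap F f = g.

Definition essentially_surjective (C D : category) (F : functor C D) : Prop :=
  forall Y : D, exists (X : C) (f : hom (F X) Y), is_iso f.

Lemma fmap_iso (C D : category) (F : functor C D) (X Y : C) (f : hom X Y) :
  is_iso f -> is_iso (fmap F f).
Proof. by move=> [g [gf fg]]; exists (fmap F g); rewrite -!fmapM gf fg !fmap1. Qed.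

Lemma power_iso (C : category) k (X Y : power C k) (f : hom X Y) :
  (forall i, is_iso (f i)) -> is_iso f.
Proof.
move=> fi; exists (fun i => sval (cid (fi i))).
by split; apply: functional_extensionality_dep => i; have [] := svalP (cid (fi i)).
Qed.

Lemma nattrans_inverse (C D : category) (F G : functor C D) (a : nattrans F G) :
  (forall X, is_iso (a X)) ->
  exists b : nattrans G F, nt_comp b a = nt_id F /\ nt_comp a b = nt_id G.
Proof.
move=> ia; pose b X := sval (cid (ia X)).
have ba X : b X ∘ a X = idc _ by have [] := svalP (cid (ia X)).
have ab X : a X ∘ b X = idc _ by have [] := svalP (cid (ia X)).
have bP X Y (f : hom X Y) : fmap F f ∘ b X = b Y ∘ fmap G f.
  rewrite -[LHS]cmp1l -(ba Y) -cmpA (cmpA (a Y)) -ntP -!cmpA ab.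
  by rewrite cmp1.
by exists (NatTrans bP); split; apply: nattrans_eq => X /=.
Qed.

Section Equivalence.
Variables (C D : category) (F : functor C D) (Gob : D -> C).
Variables (e : forall Y, hom (F (Gob Y)) Y) (e' : forall Y, hom Y (F (Gob Y))).
Variable lift : forall X Y : C, hom (F X) (F Y) -> hom X Y.
Hypotheses (eK : forall Y, e' Y ∘ e Y = idc _) (e'K : forall Y, e Y ∘ e' Y = idc _).
Hypothesis liftK : forall (X Y : C) (g : hom (F X) (F Y)), fmap F (lift g) = g.
Hypothesis Ffaithful : faithful F.

Program Definition quasi_inverse : functor D C :=
  @Functor D C Gob (fun X Y f => lift (e' Y ∘ f ∘ e X)) _ _.
Next Obligation. by move=> X; apply: Ffaithful; rewrite liftK fmap1 cmp1 eK. Qed.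
Next Obligation.
move=> X Y Z g f; apply: Ffaithful; rewrite fmapM !liftK -!cmpA.
by rewrite (cmpA (e Y)) e'K cmp1l.
Qed.

Lemma quasi_inverse_equivalence : is_equivalence F.
Proof.
exists quasi_inverse; split.
- have P (X Y : C) (f : hom X Y) :
    fmap (fcomp quasi_inverse F) f ∘ lift (e' (F X)) =
    lift (e' (F Y)) ∘ fmap (fid C) f.
    by apply: Ffaithful; rewrite !fmapM !liftK -!cmpA e'K cmp1.
  exists (@NatTrans C C (fid C) (fcomp quasi_inverse F) (fun X => lift (e' (F X))) P) => X.
  exists (lift (e (F X))).
  by split; apply: Ffaithful; rewrite /= fmapM !liftK fmap1 ?eK ?e'K.
- have P (X Y : D) (f : hom X Y) :
    fmap (fid D) f ∘ e X = e Y ∘ fmap (fcomp F quasi_inverse) f.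
    by rewrite /= liftK !cmpA e'K cmp1l.
  exists (@NatTrans D D (fcomp F quasi_inverse) (fid D) e P) => X.
  by exists (e' X); rewrite /= eK e'K.
Qed.

End Equivalence.

Lemma equivalence_of_ff_surj (C D : category) (F : functor C D) :
  faithful F -> full F -> essentially_surjective F -> is_equivalence F.
Proof.
move=> Ffaithful Ffull Fsurj.
(* Choice is used here: [is_equivalence] asks for an actual functor backwards, while surjectivity
   gives mere existence. *)
have inv (Y : D) : {X : C & {f : hom (F X) Y & {g : hom Y (F X) |
    g ∘ f = idc _ /\ f ∘ g = idc _}}}.
  have [X XP] := cid (Fsurj Y); have [f fP] := cid XP; have [g gP] := cid fP.
  by exists X, f, g.
apply: (@quasi_inverse_equivalence C D F (fun Y => projT1 (inv Y))
  (fun Y => projT1 (projT2 (inv Y))) (fun Y => sval (projT2 (projT2 (inv Y))))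
  (fun X Y g => sval (cid (Ffull X Y g)))) => //.
- by move=> Y; case: (svalP (projT2 (projT2 (inv Y)))).
- by move=> Y; case: (svalP (projT2 (projT2 (inv Y)))).
- by move=> X Y g; exact: (svalP (cid (Ffull X Y g))).
Qed.

Section UniversalArrows.
Variables (C D : category) (R : functor C D) (Lob : D -> C).
Variable eta : forall Y, hom Y (R (Lob Y)).
Variable ext : forall (Y : D) (X : C), hom Y (R X) -> hom (Lob Y) X.
Hypothesis extK : forall (Y : D) (X : C) (u : hom Y (R X)), fmap R (ext u) ∘ eta Y = u.
Hypothesis ext_eq : forall (Y : D) (X : C) (f g : hom (Lob Y) X),
  fmap R f ∘ eta Y = fmap R g ∘ eta Y -> f = g.

Program Definition left_adjoint : functor D C :=
  @Functor D C Lob (fun X Y f => ext (eta Y ∘ f)) _ _.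
Next Obligation. by move=> X; apply: ext_eq; rewrite extK fmap1 cmp1l cmp1. Qed.
Next Obligation.
move=> X Y Z g f; apply: ext_eq.
by rewrite extK fmapM -cmpA extK !cmpA extK.
Qed.

Lemma left_adjoint_adjoint : has_left_adjoint R.
Proof.
have etaP (X Y : D) (f : hom X Y) :
    fmap (fcomp R left_adjoint) f ∘ eta X = eta Y ∘ fmap (fid D) f.
  by rewrite /= extK.
have epsP (X Y : C) (f : hom X Y) :
    fmap (fid C) f ∘ ext (idc (R X)) = ext (idc (R Y)) ∘ fmap (fcomp left_adjoint R) f.
  by apply: ext_eq; rewrite !fmapM -!cmpA !extK cmp1 cmpA extK cmp1l.
exists left_adjoint, (@NatTrans D D (fid D) (fcomp R left_adjoint) eta etaP),
  (@NatTrans C C (fcomp left_adjoint R) (fid C) (fun X => ext (idc (R X))) epsP); split=> [X|Y] /=.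
  by apply: ext_eq; rewrite fmapM -cmpA extK cmpA extK cmp1l fmap1 cmp1l.
exact: extK.
Qed.

End UniversalArrows.

Lemma left_adjoint_of_universal (C D : category) (R : functor C D) :
  (forall Y : D, exists (X : C) (u : hom Y (R X)),
     forall (X' : C) (u' : hom Y (R X')), exists! h : hom X X', fmap R h ∘ u = u') ->
  has_left_adjoint R.
Proof.
move=> univ.
have arrow (Y : D) : {X : C & {u : hom Y (R X) |
    forall (X' : C) (u' : hom Y (R X')), exists! h : hom X X', fmap R h ∘ u = u'}}.
  by have [X XP] := cid (univ Y); have [u uP] := cid XP; exists X, u.
apply: (@left_adjoint_adjoint C D R (fun Y => projT1 (arrow Y))
  (fun Y => sval (projT2 (arrow Y)))
  (fun Y X u => sval (cid (svalP (projT2 (arrow Y)) X u)))).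
- by move=> Y X u; have [] := svalP (cid (svalP (projT2 (arrow Y)) X u)).
- move=> Y X f g fg.
  have [h [_ hU]] := svalP (projT2 (arrow Y)) X (fmap R g ∘ sval (projT2 (arrow Y))).
  by rewrite -(hU _ fg) -(hU _ erefl).
Qed.

(* Equivalent to [pra], with the left adjoints on slices replaced by their
   universal arrows. *)
Definition generic_factorisations (C D : category) (F : functor C D) : Prop :=
  forall (A : C) (Y : D) (y : hom Y (F A)),
  exists (X : C) (x : hom X A) (u : hom Y (F X)), fmap F x ∘ u = y /\
    forall (X' : C) (x' : hom X' A) (u' : hom Y (F X')), fmap F x' ∘ u' = y ->
    exists! h : hom X X', x' ∘ h = x /\ fmap F h ∘ u = u'.

(** An initial factorisation of [y] is a universal arrow from [y], as an object of the slice over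
    [F A], to [slice_functor F A]. *)
Lemma pra_of_generic (C D : category) (F : functor C D) :
  generic_factorisations F -> pra F.
Proof.
move=> gF A; apply: left_adjoint_of_universal => -[Y y].
have [X [x [u [xu U]]]] := gF A Y y.
exists (@SliceOb C A X x), (@SliceHom D (F A) (SliceOb y) (SliceOb (fmap F x)) u xu).
move=> [X' x'] [u' u'P]; have [h [[h1 h2] hU]] := U X' x' u' u'P.
exists (@SliceHom C A (SliceOb x) (SliceOb x') h h1); split.
  exact: slice_hom_eq.
move=> [g gP] /(congr1 (@sl_hom _ _ _ _)) /= g2; apply: slice_hom_eq.
by apply: hU; split.
Qed.

(** Factor [a A ∘ y] through [G] and lift the first factor along the naturality square at [x]. For a
    competing [(x', u')], both [fmap F h ∘ u] and [u'] solve the same lifting problem in the square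
    at [x'], hence agree. *)
Lemma generic_of_cartesian (C D : category) (F G : functor C D)
    (a : nattrans F G) :
  cartesian a -> generic_factorisations G -> generic_factorisations F.
Proof.
move=> ca gG A Y y; have [X [x [v [xv U]]]] := gG A Y (a A ∘ y).
have [_ /(_ Y v y xv) [u [[u1 u2] _]]] := ca X A x.
exists X, x, u; split=> // X' x' u' u'P.
have [h [[h1 h2] hU]] : exists! h : hom X X', x' ∘ h = x /\ fmap G h ∘ v = a X' ∘ u'.
  by apply: U; rewrite cmpA ntP -cmpA u'P.
exists h; split=> [|g [g1 g2]]; last first.
  by apply: hU; rewrite -u1 cmpA ntP -cmpA g2.
split=> //.
have e : fmap G x' ∘ (a X' ∘ u') = a A ∘ y by rewrite cmpA ntP -cmpA u'P.
have [_ /(_ Y (a X' ∘ u') y e) [w [_ wU]]] := ca X' A x'.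
rewrite -(wU u') // -(wU (fmap F h ∘ u)) //; split.
  by rewrite cmpA -ntP -cmpA u1.
by rewrite cmpA -fmapM h1.
Qed.

(** The cancellation half of the pasting law for pullbacks. It makes a morphism between functors
    over [Ttimes] cartesian when both augmentations are. *)
Lemma cartesian_cancel (C D : category) (F G H : functor C D)
    (b : nattrans G H) (a : nattrans F G) :
  cartesian b -> cartesian (nt_comp b a) -> cartesian a.
Proof.
move=> cb cba X Y f; split=> [|Q q1 q2 q]; first exact: ntP.
have e : fmap H f ∘ (b X ∘ q1) = nt_comp b a Y ∘ q2.
  by rewrite cmpA ntP -cmpA q cmpA.
have [_ /(_ Q _ _ e) [u [[u1 u2] uU]]] := cba X Y f.
exists u; split; last first.
  by move=> w [w1 w2]; apply: uU; split; rewrite //= -w1 cmpA.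
split=> //.
have [_ /(_ Q (b X ∘ q1) (a Y ∘ q2))] := cb X Y f.
rewrite cmpA ntP -cmpA q => /(_ erefl) [w [_ wU]].
rewrite -(wU q1) // -(wU (a X ∘ u)) //; split; first by rewrite cmpA -u1.
by rewrite cmpA ntP -cmpA u2.
Qed.

Lemma iso_cartesian (C D : category) (F G : functor C D) (a : nattrans F G) :
  (forall X, is_iso (a X)) -> cartesian a.
Proof.
move=> ia X Y f; split=> [|Q q1 q2 q]; first exact: ntP.
have [g [g1 g2]] := ia X; have [g' [g'1 g'2]] := ia Y.
exists (g ∘ q1); split.
  split; first by rewrite cmpA g2 cmp1l.
  rewrite -(cmp1l (_ ∘ _)) -g'1 -cmpA (cmpA (a Y)) -ntP -!cmpA (cmpA (a X)) g2.
  by rewrite cmp1l q cmpA g'1 cmp1l.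
by move=> w [<- _]; rewrite cmpA g1 cmp1l.
Qed.

(** * Limits and colimits of globular sets, cellwise *)

Lemma gmap_congr (X Y : globset) (f g : gmap X Y) j (x : X j) :
  f = g -> gm f x = gm g x.
Proof. by move=> ->. Qed.

Lemma gmap_inv (X Y : globset) (f : gmap X Y) (g : forall j, Y j -> X j) :
  (forall j (x : X j), g j (gm f x) = x) -> (forall j (y : Y j), gm f (g j y) = y) ->
  exists f' : gmap Y X, gcomp f' f = gid X /\ gcomp f f' = gid Y.
Proof.
move=> fK gK.
have gs j (y : Y j.+1) : src (g _ y) = g _ (src y).
  by rewrite -[LHS]fK -gm_src gK.
have gt j (y : Y j.+1) : tgt (g _ y) = g _ (tgt y).
  by rewrite -[LHS]fK -gm_tgt gK.
by exists (GMap gs gt); split; apply: gmap_eq => j x /=.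
Qed.

Lemma bijective_is_iso m (X Y : GSet m) (f : hom X Y) :
  (forall j, injective (@gm X Y f j)) -> (forall j (y : Y j), exists x, gm f x = y) ->
  is_iso f.
Proof.
move=> fI fS.
have [||f' [f1 f2]] := @gmap_inv X Y f (fun j y => sval (cid (fS j y))).
- by move=> j x; apply: fI; apply: (svalP (cid (fS j _))).
- by move=> j y; apply: (svalP (cid (fS j _))).
- by exists f'.
Qed.

Lemma iso_cell_inj m (X Y : GSet m) (f : hom X Y) j (x x' : X j) :
  is_iso f -> gm f x = gm f x' -> x = x'.
Proof.
move=> [g [gf _]] /(congr1 (@gm _ _ g j)) e.
by apply: etrans (esym (gmap_congr x gf)) (etrans e (gmap_congr x' gf)).
Qed.

Lemma iso_cell_surj m (X Y : GSet m) (f : hom X Y) j (y : Y j) :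
  is_iso f -> exists x : X j, gm f x = y.
Proof. by move=> [g [_ fg]]; exists (gm g y); apply: (gmap_congr y fg). Qed.

Section Pullback.
Variables (m : nat) (A B D : GSet m) (f : hom A D) (g : hom B D).

(** A concrete pullback, against which the abstract universal property is tested in order to read
    off statements about single cells. *)
Definition pb_cell (j : nat) : Small := {ab : A j * B j | gm f ab.1 = gm g ab.2}.

Lemma pb_cell_eq j (x y : pb_cell j) :
  (sval x).1 = (sval y).1 -> (sval x).2 = (sval y).2 -> x = y.
Proof.
case: x y => -[a b] ab [[a' b'] ab'] /= e e'; subst a' b'; congr exist.
exact: Prop_irrelevance.
Qed.

Program Definition pb_src j (x : pb_cell j.+1) : pb_cell j :=
  exist _ (src (sval x).1, src (sval x).2) _.
Next Obligation. by move=> j [[a b] /= ab]; rewrite -!gm_src ab. Qed.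

Program Definition pb_tgt j (x : pb_cell j.+1) : pb_cell j :=
  exist _ (tgt (sval x).1, tgt (sval x).2) _.
Next Obligation. by move=> j [[a b] /= ab]; rewrite -!gm_tgt ab. Qed.

Program Definition pb_globset : globset := @GlobSet pb_cell pb_src pb_tgt _ _.
Next Obligation. by move=> j x; apply: pb_cell_eq; rewrite /= src_glob. Qed.
Next Obligation. by move=> j x; apply: pb_cell_eq; rewrite /= tgt_glob. Qed.

Program Definition pb : mglobset m := @MGlobSet m pb_globset _.
Next Obligation. by move=> j mj [[a _] _]; apply: gset_trunc mj a. Qed.

Definition pb1 : @hom (GSet m) pb A :=
  @GMap pb A (fun j x => (sval x).1) (fun j x => erefl) (fun j x => erefl).

Definition pb2 : @hom (GSet m) pb B :=
  @GMap pb B (fun j x => (sval x).2) (fun j x => erefl) (fun j x => erefl).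

Lemma pb_comm : f ∘ pb1 = g ∘ pb2.
Proof. by apply: gmap_eq => j x; apply: svalP x. Qed.

Variables (P : GSet m) (p1 : hom P A) (p2 : hom P B).

Lemma pullback_of_cells :
  (forall j (x : P j), gm f (gm p1 x) = gm g (gm p2 x)) ->
  (forall j (a : A j) (b : B j), gm f a = gm g b ->
     exists x : P j, gm p1 x = a /\ gm p2 x = b) ->
  (forall j (x y : P j), gm p1 x = gm p1 y -> gm p2 x = gm p2 y -> x = y) ->
  is_pullback p1 p2 f g.
Proof.
move=> fg pS pI; split=> [|Q q1 q2 q]; first by apply: gmap_eq => j x; apply: fg.
have qx j (z : Q j) := pS j _ _ (gmap_congr z q).
pose u j (z : Q j) := sval (cid (qx j z)).
have u1 j z : gm p1 (u j z) = gm q1 z by have [] := svalP (cid (qx j z)).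
have u2 j z : gm p2 (u j z) = gm q2 z by have [] := svalP (cid (qx j z)).
have us j (z : Q j.+1) : src (u _ z) = u _ (src z).
  by apply: pI; rewrite ?u1 ?u2 -gm_src ?u1 ?u2 gm_src.
have ut j (z : Q j.+1) : tgt (u _ z) = u _ (tgt z).
  by apply: pI; rewrite ?u1 ?u2 -gm_tgt ?u1 ?u2 gm_tgt.
exists (GMap us ut); split; first by split; apply: gmap_eq => j x /=.
move=> w [w1 w2]; apply: gmap_eq => j x; apply: pI => /=.
  by rewrite u1; apply: (esym (gmap_congr x w1)).
by rewrite u2; apply: (esym (gmap_congr x w2)).
Qed.

Hypothesis isP : is_pullback p1 p2 f g.

Lemma pullback_cell_ex j (a : A j) (b : B j) : gm f a = gm g b ->
  exists x : P j, gm p1 x = a /\ gm p2 x = b.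
Proof.
move=> ab; have [_ /(_ pb pb1 pb2 pb_comm) [u [[u1 u2] _]]] := isP.
exists (gm u (exist _ (a, b) ab : pb j)); split.
  exact: (gmap_congr (exist _ (a, b) ab : pb j) u1).
exact: (gmap_congr (exist _ (a, b) ab : pb j) u2).
Qed.

(** The comparison [v'] from [P] to the concrete pullback has a left inverse [u], by uniqueness of
    maps into [P]; so a cell is determined by its two projections. *)
Lemma pullback_cell_inj j (x y : P j) :
  gm p1 x = gm p1 y -> gm p2 x = gm p2 y -> x = y.
Proof.
have [fp /(_ pb pb1 pb2 pb_comm) [u [[u1 u2] _]]] := isP.
pose v j (x : P j) : pb j := exist _ (gm p1 x, gm p2 x) (gmap_congr x fp).
have vs i (z : P i.+1) : src (v _ z) = v _ (src z).
  by apply: pb_cell_eq; rewrite /= gm_src.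
have vt i (z : P i.+1) : tgt (v _ z) = v _ (tgt z).
  by apply: pb_cell_eq; rewrite /= gm_tgt.
pose v' : @hom (GSet m) P pb := GMap vs vt.
have uv : u ∘ v' = idc P.
  have [_ /(_ P p1 p2 fp) [w [_ wU]]] := isP.
  have uv1 : p1 ∘ (u ∘ v') = p1 by rewrite cmpA u1; apply: gmap_eq.
  have uv2 : p2 ∘ (u ∘ v') = p2 by rewrite cmpA u2; apply: gmap_eq.
  apply: etrans (wU (idc P) _); last by rewrite !cmp1.
  exact: (esym (wU _ (conj uv1 uv2))).
move=> e1 e2; have uvE i (z : P i) : gm u (v i z) = z := gmap_congr z uv.
rewrite -[LHS]uvE -[RHS]uvE; by congr (gm u _); apply: pb_cell_eq.
Qed.

End Pullback.

Section Coproduct.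
Variables (m : nat) (I : Small) (Y : I -> GSet m).

Program Definition cop_globset : globset :=
  @GlobSet (fun j => {i : I & Y i j})
    (fun j x => existT _ (tag x) (src (tagged x)))
    (fun j x => existT _ (tag x) (tgt (tagged x))) _ _.
Next Obligation. by move=> j x; rewrite /= src_glob. Qed.
Next Obligation. by move=> j x; rewrite /= tgt_glob. Qed.

Program Definition cop : mglobset m := @MGlobSet m cop_globset _.
Next Obligation. by move=> j mj [i x]; apply: gset_trunc mj x. Qed.

Definition cop_in (i : I) : @hom (GSet m) (Y i) cop :=
  @GMap (Y i) cop (fun j x => existT _ i x) (fun j x => erefl) (fun j x => erefl).

Variables (Z : GSet m) (inj : forall i, hom (Y i) Z).

Definition cells_coproduct : Prop := forall j (z : Z j),
  exists! c : {i : I & Y i j}, gm (inj (tag c)) (tagged c) = z.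

Lemma coproduct_of_cells : cells_coproduct -> is_coproduct inj.
Proof.
move=> zP W g.
pose c j (z : Z j) := sval (cid (zP j z)).
have cK j (z : Z j) : gm (inj (tag (c j z))) (tagged (c j z)) = z.
  by have [] := svalP (cid (zP j z)).
have cE j i (y : Y i j) : c j (gm (inj i) y) = existT _ i y.
  have [_ U] := svalP (cid (zP j (gm (inj i) y))).
  by apply: (U (existT _ i y)).
pose u j (z : Z j) := gm (g (tag (c j z))) (tagged (c j z)).
have us j (z : Z j.+1) : src (u _ z) = u _ (src z).
  by rewrite -(cK _ z) gm_src /u !cE /= gm_src.
have ut j (z : Z j.+1) : tgt (u _ z) = u _ (tgt z).
  by rewrite -(cK _ z) gm_tgt /u !cE /= gm_tgt.
exists (GMap us ut); split; first by move=> i; apply: gmap_eq => j x; rewrite /= /u cE.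
move=> v vP; apply: gmap_eq => j z /=.
by rewrite -{2}(cK _ z); apply: (esym (gmap_congr _ (vP _))).
Qed.

(** Comparison with the concrete disjoint union [cop]: the two induced maps are mutually inverse, by
    uniqueness on one side and by computation on summands on the other. *)
Lemma cells_of_coproduct : is_coproduct inj -> cells_coproduct.
Proof.
move=> cZ; have [u [uP _]] := cZ cop cop_in.
pose v j (c : cop j) : Z j := gm (inj (tag c)) (tagged c).
have vs j (c : cop j.+1) : src (v _ c) = v _ (src c) by rewrite /v gm_src.
have vt j (c : cop j.+1) : tgt (v _ c) = v _ (tgt c) by rewrite /v gm_tgt.
pose v' : @hom (GSet m) cop Z := GMap vs vt.
have vu : v' ∘ u = idc Z.
  have [w [_ wU]] := cZ Z inj.
  have vui i : (v' ∘ u) ∘ inj i = inj i by rewrite -cmpA uP; apply: gmap_eq.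
  apply: etrans (wU (idc Z) _); last by move=> i; rewrite cmp1l.
  exact: (esym (wU _ vui)).
have uv j (c : cop j) : gm u (v j c) = c.
  by case: c => i y; apply: (gmap_congr y (uP i)).
move=> j z; exists (gm u z); split; first exact: (gmap_congr z vu).
by move=> c <-; rewrite -[RHS]uv.
Qed.

End Coproduct.

(** Disjoint unions are stable under pullback: the image of [z] under [a Z] lies in exactly one
    summand of [G Z], and the naturality square at [inj i] lifts it to exactly one cell of
    [F (Y i)]. *)
Lemma preserves_coproducts_cartesian (m : nat) (C : category)
    (F G : functor C (GSet m)) (a : nattrans F G) :
  cartesian a -> preserves_coproducts G -> preserves_coproducts F.
Proof.
move=> ca pG I Y Z inj iZ; apply: coproduct_of_cells => j z.
have [[i y] [/= e U]] := cells_of_coproduct (pG I Y Z inj iZ) (gm (a Z) z).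
have [x [x1 x2]] := pullback_cell_ex (ca _ _ (inj i)) e.
exists (existT _ i x); split=> // -[i' x'] /= x'z.
have := U (existT _ i' (gm (a (Y i')) x')).
move=> /(_ (etrans (gmap_congr x' (ntP a (inj i'))) (congr1 _ x'z))) e'.
have ii : i = i' := congr1 (@tag _ _) e'.
subst i'; congr existT; move: (existT_inj e'); rewrite -x1 => e1.
by apply: (pullback_cell_inj (ca _ _ (inj i))); rewrite ?x2 // x1 -e1.
Qed.

Lemma preserves_each_cartesian (m k : nat) (F G : functor (power (GSet m) k) (GSet m))
    (a : nattrans F G) :
  cartesian a -> preserves_coproducts_each G -> preserves_coproducts_each F.
Proof.
move=> ca pG X i.
have P Y Y' (f : hom Y Y') : fmap (fcomp G (plug X i)) f ∘ a (plug X i Y) =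
    a (plug X i Y') ∘ fmap (fcomp F (plug X i)) f by apply: ntP.
pose a' : nattrans (fcomp F (plug X i)) (fcomp G (plug X i)) :=
  @NatTrans _ _ (fcomp F (plug X i)) (fcomp G (plug X i)) (fun Y => a (plug X i Y)) P.
have ca' : cartesian a' by move=> Y Y' f; apply: ca.
exact: (preserves_coproducts_cartesian ca' (pG X i)).
Qed.

(** * Generic factorisations for the free strict category functor *)

(** Shapes of two cells of [T X] are usually equal by a proof and not by computation, so their maps
    can only be compared after transport. *)
Definition tree_cast (i : nat) (p q : Tr i) (e : p = q) (j : nat) (x : tree p j) :
    tree q j :=
  match e in _ = q' return tree q' j with erefl => x end.

Lemma tree_castK i (p : Tr i) (e : p = p) j (x : tree p j) : tree_cast e x = x.
Proof. by rewrite (Prop_irrelevance e erefl). Qed.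

Lemma tree_cast_trans i (p q r : Tr i) (e : p = q) (e' : q = r) (e'' : p = r) j
    (x : tree p j) : tree_cast e' (tree_cast e x) = tree_cast e'' x.
Proof. by subst q r; rewrite !tree_castK. Qed.

Lemma tree_cast_src i (p q : Tr i) (e : p = q) j (x : tree p j.+1) :
  src (tree_cast e x) = tree_cast e (src x).
Proof. by subst q. Qed.

Lemma tree_cast_tgt i (p q : Tr i) (e : p = q) j (x : tree p j.+1) :
  tgt (tree_cast e x) = tree_cast e (tgt x).
Proof. by subst q. Qed.

Lemma tree_cast_sigma i (p q : Tr i.+1) (e : p = q) (e' : bd p = bd q) j
    (x : tree (bd p) j) : tree_cast e (gm (sigma p) x) = gm (sigma q) (tree_cast e' x).
Proof. by subst q; rewrite !tree_castK. Qed.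

Lemma tree_cast_tau i (p q : Tr i.+1) (e : p = q) (e' : bd p = bd q) j
    (x : tree (bd p) j) : tree_cast e (gm (tau p) x) = gm (tau q) (tree_cast e' x).
Proof. by subst q; rewrite !tree_castK. Qed.

Lemma tcell_cast_eq m (X : globset) j (c d : tset m X j)
    (e : tc_shape c = tc_shape d) :
  (forall i (x : tree (tc_shape c) i), gm (tc_map c) x = gm (tc_map d) (tree_cast e x)) ->
  c = d.
Proof.
case: c d e => h p f [h' q g] /= e; subst q => fg.
by apply: tcell_eq; apply: gmap_eq => i x; rewrite fg.
Qed.

Lemma tcell_cast m (X : globset) j (c d : tset m X j) (e : tc_shape c = tc_shape d)
    i (x : tree (tc_shape c) i) :
  c = d -> gm (tc_map c) x = gm (tc_map d) (tree_cast e x).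
Proof. by move=> cd; subst d; rewrite tree_castK. Qed.

Section GenericT.
Variables (m : nat) (A Y : mglobset m) (y : gmap Y (T m A)).

Definition shape j (c : Y j) : Tr j := tc_shape (gm y c).

(** Satisfied by every [u] that factors [y], since [Tmap] leaves shapes alone; this is why one
    object can serve all factorisations. *)
Definition over_shape (X : mglobset m) (u : gmap Y (T m X)) : Prop :=
  forall j (c : Y j), tc_shape (gm u c) = shape c.

(* The coproduct of the trees [shape c]; the generic object is its quotient by
   the coarsest identifications that every [u] over the given shapes respects. *)
Definition shape_cell (j : nat) : Small := {i : nat & {c : Y i & tree (shape c) j}}.

Definition shape_in i (c : Y i) j (x : tree (shape c) j) : shape_cell j :=
  existT _ i (existT _ c x).

Definition shape_src j (z : shape_cell j.+1) : shape_cell j :=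
  shape_in (src (tagged (tagged z))).

Definition shape_tgt j (z : shape_cell j.+1) : shape_cell j :=
  shape_in (tgt (tagged (tagged z))).

Definition shape_eval (X : mglobset m) (u : gmap Y (T m X)) (e : over_shape u) j
    (z : shape_cell j) : X j :=
  gm (tc_map (gm u (tag (tagged z)))) (tree_cast (esym (e _ _)) (tagged (tagged z))).

Lemma shape_eval_src (X : mglobset m) (u : gmap Y (T m X)) (e : over_shape u) j
    (z : shape_cell j.+1) : src (shape_eval e z) = shape_eval e (shape_src z).
Proof. by rewrite /shape_eval gm_src tree_cast_src. Qed.

Lemma shape_eval_tgt (X : mglobset m) (u : gmap Y (T m X)) (e : over_shape u) j
    (z : shape_cell j.+1) : tgt (shape_eval e z) = shape_eval e (shape_tgt z).
Proof. by rewrite /shape_eval gm_tgt tree_cast_tgt. Qed.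

(** Every [u] commutes with boundaries, so the gluings along [sigma] and [tau] are contained in this
    relation. It lies in [Prop], which keeps the quotient in [Small] although all [X] are quantified
    over. *)
Definition shape_rel j (z z' : shape_cell j) : Prop :=
  forall (X : mglobset m) (u : gmap Y (T m X)) (e : over_shape u),
    shape_eval e z = shape_eval e z'.

Definition quot_cell (j : nat) : Small :=
  {P : shape_cell j -> Prop | exists z, P = shape_rel z}.

Definition quot_class j (z : shape_cell j) : quot_cell j :=
  exist _ (shape_rel z) (ex_intro _ z erefl).

Definition quot_repr j (q : quot_cell j) : shape_cell j := sval (cid (svalP q)).

Lemma quot_reprK j (q : quot_cell j) : quot_class (quot_repr q) = q.
Proof.
rewrite /quot_class /quot_repr; case: q => P PP; case: (cid _) => z /= Pz.
by subst P; congr exist; apply: Prop_irrelevance.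
Qed.

Lemma quot_class_eq j (z z' : shape_cell j) :
  shape_rel z z' -> quot_class z = quot_class z'.
Proof.
move=> zz'; have e : shape_rel z = shape_rel z'.
  apply: functional_extensionality_dep => w; apply: propext.
  by split=> zw X u ou; rewrite -?zw ?zz' // -zz'.
rewrite /quot_class; move: (ex_intro _ z _) (ex_intro _ z' _).
by rewrite e => p p'; congr exist; apply: Prop_irrelevance.
Qed.

Lemma quot_repr_rel j (z : shape_cell j) : shape_rel (quot_repr (quot_class z)) z.
Proof.
have /(congr1 (fun P => P z)) /= e := congr1 sval (quot_reprK (quot_class z)).
by rewrite e.
Qed.

Program Definition quot_globset : globset :=
  @GlobSet quot_cell (fun j q => quot_class (shape_src (quot_repr q)))
    (fun j q => quot_class (shape_tgt (quot_repr q))) _ _.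
Next Obligation.
move=> j q; apply: quot_class_eq => X u e.
by rewrite -!shape_eval_src !quot_repr_rel -shape_eval_src -shape_eval_tgt src_glob.
Qed.
Next Obligation.
move=> j q; apply: quot_class_eq => X u e.
by rewrite -!shape_eval_tgt !quot_repr_rel -shape_eval_src -shape_eval_tgt tgt_glob.
Qed.

Lemma quot_src j (z : shape_cell j.+1) :
  @src quot_globset j (quot_class z) = quot_class (shape_src z).
Proof.
by apply: quot_class_eq => X u e; rewrite -!shape_eval_src quot_repr_rel.
Qed.

Lemma quot_tgt j (z : shape_cell j.+1) :
  @tgt quot_globset j (quot_class z) = quot_class (shape_tgt z).
Proof.
by apply: quot_class_eq => X u e; rewrite -!shape_eval_tgt quot_repr_rel.
Qed.

Lemma over_shape_id : over_shape y. Proof. by []. Qed.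

Program Definition quot : mglobset m := @MGlobSet m quot_globset _.
Next Obligation.
(* The map [y] is itself over the shapes, so a cell of the quotient evaluates to a cell of [A],
   which has none above dimension [m]. *)
move=> j mj q; exact: (@gset_trunc m A j mj (shape_eval over_shape_id (quot_repr q))).
Qed.

Program Definition quot_lift (X : mglobset m) (u : gmap Y (T m X)) (e : over_shape u) :
    @hom (GSet m) quot X :=
  @GMap quot X (fun j q => shape_eval e (quot_repr q)) _ _.
Next Obligation. by move=> X u e j q; rewrite shape_eval_src /= quot_repr_rel. Qed.
Next Obligation. by move=> X u e j q; rewrite shape_eval_tgt /= quot_repr_rel. Qed.

Lemma quot_liftE (X : mglobset m) (u : gmap Y (T m X)) (e : over_shape u) j
    (z : shape_cell j) : gm (quot_lift e) (quot_class z) = shape_eval e z.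
Proof. exact: quot_repr_rel. Qed.

Lemma quot_unit_dim j (c : Y j) : j <= m.
Proof. by rewrite leqNgt; apply/negP => mj; apply: gset_trunc mj c. Qed.

Program Definition quot_unit_map j (c : Y j) : gmap (tree (shape c)) quot :=
  @GMap (tree (shape c)) quot (fun i x => quot_class (shape_in x)) _ _.
Next Obligation. by move=> j c i x; rewrite quot_src. Qed.
Next Obligation. by move=> j c i x; rewrite quot_tgt. Qed.

Definition quot_unit_cell j (c : Y j) : T m quot j :=
  TCell (quot_unit_dim c) (quot_unit_map c).

(** Compatibility with boundaries is where the gluing matters: a cell of the tree of [src c] and its
    image under [sigma] in the tree of [c] are identified, because each [u] satisfies
    [src (u c) = u (src c)]. *)
Program Definition quot_unit : @hom (GSet m) Y (T m quot) :=
  @GMap Y (T m quot) quot_unit_cell _ _.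
Next Obligation.
move=> j c; have e : bd (shape c) = shape (src c) := congr1 (@tc_shape _ _ _) (gm_src y c).
apply: (@tcell_cast_eq m quot j (src (quot_unit_cell c)) (quot_unit_cell (src c)) e) => i x /=.
apply: quot_class_eq => X u eu; rewrite /shape_eval /=.
rewrite (tree_cast_sigma _ (congr1 (@bd _) (esym (eu _ c)))).
have e1 : tc_shape (src (gm u c)) = tc_shape (gm u (src c)) by rewrite gm_src.
have /= -> := tcell_cast e1 (tree_cast (congr1 (@bd _) (esym (eu _ c))) x) (gm_src u c).
(* Each side carries two successive transports; both pairs collapse to the same single one. *)
rewrite (tree_cast_trans _ _ (etrans e (esym (eu _ (src c))))).
by rewrite (tree_cast_trans _ _ (etrans e (esym (eu _ (src c))))).
Qed.
Next Obligation.
move=> j c; have e : bd (shape c) = shape (tgt c) := congr1 (@tc_shape _ _ _) (gm_tgt y c).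
apply: (@tcell_cast_eq m quot j (tgt (quot_unit_cell c)) (quot_unit_cell (tgt c)) e) => i x /=.
apply: quot_class_eq => X u eu; rewrite /shape_eval /=.
rewrite (tree_cast_tau _ (congr1 (@bd _) (esym (eu _ c)))).
have e1 : tc_shape (tgt (gm u c)) = tc_shape (gm u (tgt c)) by rewrite gm_tgt.
have /= -> := tcell_cast e1 (tree_cast (congr1 (@bd _) (esym (eu _ c))) x) (gm_tgt u c).
rewrite (tree_cast_trans _ _ (etrans e (esym (eu _ (tgt c))))).
by rewrite (tree_cast_trans _ _ (etrans e (esym (eu _ (tgt c))))).
Qed.

Lemma quot_lift_unit (X : mglobset m) (u : gmap Y (T m X)) (e : over_shape u) :
  fmap (T m) (quot_lift e) ∘ quot_unit = u.
Proof.
apply: gmap_eq => j c; apply: (@tcell_cast_eq m X j (gm (Tmap m (quot_lift e)) (quot_unit_cell c)) (gm u c)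
  (esym (e j c))) => i x.
exact: (quot_liftE e (shape_in x)).
Qed.

(** Every cell of [quot] is the class of a cell in some tree [shape c], and there a map out of
    [quot] is visible in its composite with the unit. *)
Lemma quot_unit_inj (X : mglobset m) (g h : @hom (GSet m) quot X) :
  fmap (T m) g ∘ quot_unit = fmap (T m) h ∘ quot_unit -> g = h.
Proof.
move=> gh; apply: gmap_eq => j q; rewrite -(quot_reprK q).
case: (quot_repr q) => i [c x].
exact: (@tcell_cast m X i (gm (Tmap m g) (quot_unit_cell c))
  (gm (Tmap m h) (quot_unit_cell c)) erefl j x (gmap_congr c gh)).
Qed.

Lemma over_shape_map (X : mglobset m) (x : @hom (GSet m) X A) (u : @hom (GSet m) Y (T m X)) :
  fmap (T m) x ∘ u = y -> over_shape u.
Proof. by move=> xu j c; rewrite /shape -xu. Qed.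

End GenericT.

Lemma generic_T m : generic_factorisations (T m).
Proof.
move=> A Y y; exists (quot y), (quot_lift (over_shape_id y)), (quot_unit y).
split=> [|X x u xu]; first exact: quot_lift_unit.
exists (quot_lift (over_shape_map xu)); split; last first.
  by move=> h [_ hu]; apply: quot_unit_inj; rewrite hu quot_lift_unit.
split; last exact: quot_lift_unit.
by apply: quot_unit_inj; rewrite fmapM -cmpA !quot_lift_unit.
Qed.

(** Maps into the product and maps in [power] are both tuples, so the factorisation is taken in each
    coordinate separately. *)
Lemma generic_Ttimes n k : generic_factorisations (Ttimes n k).
Proof.
move=> A Y y.
pose pr i : gmap Y (T n (A i)) := @GMap Y (T n (A i)) (fun j c => pc_val (gm y c) i)
  (fun j c => congr1 (fun d => pc_val d i) (gm_src y c))
  (fun j c => congr1 (fun d => pc_val d i) (gm_tgt y c)).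
have gT i := cid (@generic_T n (A i) Y (pr i)).
pose X i := sval (gT i).
have xT i := cid (svalP (gT i)).
pose x i := sval (xT i).
have uT i := cid (svalP (xT i)).
pose u i := sval (uT i).
have uP i : fmap (T n) (x i) ∘ u i = pr i := proj1 (svalP (uT i)).
have U i := proj2 (svalP (uT i)).
(* Obtained from [Y], since for [k = 0] no coordinate could supply the bound. *)
have dim j (c : Y j) : j <= n by rewrite leqNgt; apply/negP => nj; apply: gset_trunc nj c.
pose w j (c : Y j) : Ttimes n k X j :=
  @PCell n k (fun i => tset n (X i)) j (dim j c) (fun i => gm (u i) c).
have ws j (c : Y j.+1) : src (w _ c) = w _ (src c).
  by apply: pcell_eq => i /=; rewrite -gm_src.
have wt j (c : Y j.+1) : tgt (w _ c) = w _ (tgt c).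
  by apply: pcell_eq => i /=; rewrite -gm_tgt.
exists X, x, (GMap ws wt); split.
  by apply: gmap_eq => j c; apply: pcell_eq => i; apply: (gmap_congr c (uP i)).
move=> X' x' u' u'P.
pose v i : gmap Y (T n (X' i)) := @GMap Y (T n (X' i)) (fun j c => pc_val (gm u' c) i)
  (fun j c => congr1 (fun d => pc_val d i) (gm_src u' c))
  (fun j c => congr1 (fun d => pc_val d i) (gm_tgt u' c)).
have vP i : fmap (T n) (x' i) ∘ v i = pr i.
  apply: gmap_eq => j c.
  exact: (congr1 (fun d : Ttimes n k A j => pc_val d i) (gmap_congr c u'P)).
have hT i := cid (U i (X' i) (x' i) (v i) (vP i)).
exists (fun i => sval (hT i)); split.
  split; first by apply: functional_extensionality_dep => i; have [[]] := svalP (hT i).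
  apply: gmap_eq => j c; apply: pcell_eq => i.
  by have [[_ h2] _] := svalP (hT i); apply: (gmap_congr c h2).
move=> h [h1 h2]; apply: functional_extensionality_dep => i.
have [_ hU] := svalP (hT i); apply: hU; split; first by rewrite -/(x i) -h1.
apply: gmap_eq => j c.
exact: (congr1 (fun d : Ttimes n k X' j => pc_val d i) (gmap_congr c h2)).
Qed.

(** * Distributivity *)

(** Will be applied to the index of the summand hit by a cell; such an index cannot change along
    sources and targets. *)
Lemma gseq_connected k (P : 'I_k -> globset) (pt : forall i, P i 0) (I : Type)
    (kappa : forall j, gseq P j -> I) :
  (forall j (x : gseq P j.+1), kappa j (src x) = kappa j.+1 x) ->
  (forall j (x : gseq P j.+1), kappa j (tgt x) = kappa j.+1 x) ->
  forall j (x : gseq P j), kappa j x = kappa 0 (ord0 : 'I_k.+1).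
Proof.
move=> ks kt; elim=> [|j IH] x; last by rewrite -ks.
case: x => m mk; elim: m mk => [|m IH] mk.
  by congr (kappa 0 _); apply: val_inj.
rewrite -(IH (ltnW mk)); have mk' : m < k by [].
(* A 0-cell of the hom at [m] is a 1-cell from vertex [m] to vertex [m.+1]. *)
pose x : gseq P 1 := existT _ (Ordinal mk') (pt (Ordinal mk')).
have -> : Ordinal mk = @tgt (gseq P) 0 x by apply: val_inj.
have -> : Ordinal (ltnW mk) = @src (gseq P) 0 x by apply: val_inj.
by rewrite ks kt.
Qed.

Lemma tree_connected i (p : Tr i) (I : Type) (kappa : forall j, tree p j -> I) :
  (forall j (x : tree p j.+1), kappa j (src x) = kappa j.+1 x) ->
  (forall j (x : tree p j.+1), kappa j (tgt x) = kappa j.+1 x) ->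
  forall j (x : tree p j), kappa j x = kappa 0 (tree_pt p).
Proof.
case: i p kappa => [|i] p kappa ks kt; first by case=> [|j] [].
exact: (gseq_connected (fun a => tree_pt (projT2 p a)) ks kt).
Qed.

Lemma T_cells_coproduct m (I : Small) (Y : I -> GSet m) (Z : GSet m)
    (inj : forall i, hom (Y i) Z) :
  cells_coproduct inj -> cells_coproduct (fun i => fmap (T m) (inj i)).
Proof.
move=> zP.
have inj_inj i j (y y' : Y i j) : gm (inj i) y = gm (inj i) y' -> y = y'.
  move=> e; have [c [_ U]] := zP j (gm (inj i) y'); apply: (@existT_inj I (fun i => Y i j)).
  by rewrite -(U (existT _ i y) e) -(U (existT _ i y') erefl).
have inj_tag i i' j (y : Y i j) (y' : Y i' j) : gm (inj i) y = gm (inj i') y' -> i = i'.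
  move=> e; have [c [_ U]] := zP j (gm (inj i') y').
  have := U (existT _ i y) e; rewrite (U (existT _ i' y') erefl).
  by move/(congr1 (@tag _ _)).
move=> j [h p f].
pose c a (x : tree p a) := sval (cid (zP a (gm f x))).
have cK a (x : tree p a) : gm (inj (tag (c a x))) (tagged (c a x)) = gm f x.
  by have [] := svalP (cid (zP a (gm f x))).
have ks a (x : tree p a.+1) : tag (c _ (src x)) = tag (c _ x).
  apply: (@inj_tag _ _ _ (tagged (c _ (src x))) (src (tagged (c _ x)))).
  by rewrite (cK _ (src x)) -!gm_src (cK _ x).
have kt a (x : tree p a.+1) : tag (c _ (tgt x)) = tag (c _ x).
  apply: (@inj_tag _ _ _ (tagged (c _ (tgt x))) (tgt (tagged (c _ x)))).
  by rewrite (cK _ (tgt x)) -!gm_tgt (cK _ x).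
(* By connectedness the whole tree lands in the summand of its base vertex. *)
set i := tag (c 0 (tree_pt p)).
have ex a (x : tree p a) : exists y : Y i a, gm (inj i) y = gm f x.
  have := @tree_connected j p I (fun a x => tag (c a x)) ks kt a x; rewrite -/i; have := cK a x.
  by case: (c a x) => i' y /= yx ii'; rewrite -ii'; exists y.
pose g a (x : tree p a) := sval (cid (ex a x)).
have gK a (x : tree p a) : gm (inj i) (g a x) = gm f x := svalP (cid (ex a x)).
have gs a (x : tree p a.+1) : src (g _ x) = g _ (src x).
  by apply: inj_inj; rewrite -gm_src !gK gm_src.
have gt a (x : tree p a.+1) : tgt (g _ x) = g _ (tgt x).
  by apply: inj_inj; rewrite -gm_tgt !gK gm_tgt.
exists (existT _ i (@TCell m (Y i) j h p (GMap gs gt))); split.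
  by apply: tcell_eq; apply: gmap_eq.
move=> [i' [h' p' f']] /= e.
have ep : p = p' := esym (congr1 (@tc_shape _ _ _) e); subst p'.
have ef a (x : tree p a) : gm (inj i') (gm f' x) = gm f x.
  exact: (@tcell_cast m Z j (TCell h' (gcomp (inj i') f')) (TCell h f) erefl a x e).
have ii' : i = i' by apply: (@inj_tag _ _ _ (g 0 (tree_pt p)) (gm f' (tree_pt p))); rewrite gK ef.
subst i'; congr existT; apply: tcell_eq; apply: gmap_eq => a x.
by apply: inj_inj; rewrite /= gK -ef.
Qed.

Section Plug.
Variables (n : nat) (I : Small) (Y : I -> GSet n) (Z X : GSet n).
Variable inj : forall a, hom (Y a) Z.

(** The coordinates of [plug_hom] with the test [i' == i] abstracted to a boolean, so that case
    analysis goes through the dependent types. *)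
Definition plug_if (b : bool) (a : I) :
    hom (if b then Y a else X) (if b then Z else X) :=
  match b return hom (if b then Y a else X) (if b then Z else X) with
  | true => inj a
  | false => idc X
  end.

Lemma plug_true (b : bool) : b -> cells_coproduct inj ->
  cells_coproduct (fun a => fmap (T n) (plug_if b a)).
Proof. by case: b => // _; apply: T_cells_coproduct. Qed.

Lemma plug_false (b : bool) : ~~ b -> forall a j (z : T n (if b then Z else X) j),
  exists! y, gm (fmap (T n) (plug_if b a)) y = z.
Proof.
case: b => // _ a j z; exists z; split; first exact: (gmap_congr z (fmap1 (T n) X)).
by move=> y <-; apply: (gmap_congr y (fmap1 (T n) X)).
Qed.

End Plug.

(** The [i]-th coordinate of a cell selects the summand and lifts there uniquely; in all other
    coordinates the plugged map is an identity. *)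
Lemma preserves_Ttimes n k : preserves_coproducts_each (Ttimes n k).
Proof.
move=> X i I Y Z inj iZ; have {iZ} cZ := cells_of_coproduct iZ.
apply: coproduct_of_cells => j z.
have ii : i == i by [].
have cZi : forall i' : 'I_k, i' == i -> _ := fun i' b => @plug_true n I Y Z (X i') inj _ b cZ.
have [[a y0] [y0P U]] := cZi i ii j (pc_val z i).
have ex i' : exists y : T n (plug_ob X i (Y a) i') j,
    gm (fmap (T n) (plug_if (X i') inj (i' == i) a)) y = pc_val z i'.
  have /orP [/eqP e|ne] := orbN (i' == i); first by subst i'; exists y0.
  by have [y [yP _]] := plug_false inj ne a (pc_val z i'); exists y.
exists (existT _ a (@PCell n k (fun i' => tset n (plug_ob X i (Y a) i')) j (pc_dim z)
                      (fun i' => sval (cid (ex i'))))); split.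
  by apply: pcell_eq => i'; apply: (svalP (cid (ex i'))).
move=> [a' y'] y'P.
have e i' : gm (fmap (T n) (plug_if (X i') inj (i' == i) a')) (pc_val y' i') = pc_val z i'.
  exact: (congr1 (fun c : Ttimes n k (plug_ob X i Z) j => pc_val c i') y'P).
have aa' : a = a' := congr1 (@tag _ _) (U (existT _ a' (pc_val y' i)) (e i)).
subst a'; congr existT; apply: pcell_eq => i' /=; case: (cid (ex i')) => y /= yP.
have /orP [/eqP ei|ne] := orbN (i' == i).
  subst i'; apply: (@existT_inj I (fun a => T n (plug_ob X i (Y a) i) j)).
  by rewrite -(U (existT _ a y) yP); apply: U (existT _ a (pc_val y' i)) (e i).
have [y1 [_ U1]] := plug_false inj ne a (pc_val z i').
by rewrite -(U1 y yP); apply: U1 (e i').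
Qed.

(** * The functor is well defined *)

Lemma nc_aug_pt n (A : ncoll n) (X : mglobset n.+1) (y : A X 0) (x : X 0) :
  gm (nc_aug A X) y = vtx n.+1 x -> y = nc_pt A x.
Proof. by move=> e; apply: nc_aug0_inj; rewrite e nc_id0. Qed.

Lemma bar_augE n (A : ncoll n) k (X : power (GSet n) k) j (x : bar_ob A X j) :
  hc (iota_hcell (gm (bar_aug A k X) x)) = gm (nc_aug A (mseq X)) (hc x).
Proof. exact: (congr1 (@hc _ _ _ _) (theta_cellK _)). Qed.

(** The augmentation is injective on 0-cells, so the end points of [y] can be read off from those of
    its image. *)
Lemma bar_lift n (A : ncoll n) k (X : power (GSet n) k) j (y : A (mseq X) j.+1)
    (c : Ttimes n k X j) : gm (nc_aug A (mseq X)) y = hc (iota_hcell c) ->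
  exists y' : bar_ob A X j, hc y' = y /\ gm (bar_aug A k X) y' = c.
Proof.
move=> yc.
have s0 : src0 y = nc_pt A (ord0 : mseq X 0).
  by apply: nc_aug_pt; rewrite -gm_src0 yc; apply: hc_src0.
have t0 : tgt0 y = nc_pt A (ord_max : mseq X 0).
  by apply: nc_aug_pt; rewrite -gm_tgt0 yc; apply: hc_tgt0.
exists (HCell s0 t0); split=> //.
by apply: iota_inj; apply: hcell_eq; rewrite bar_augE.
Qed.

(** The square is the naturality square of [nc_aug A] at [fmap (seqF n k) f], restricted to homs;
    [bar_lift] places the lifted cell in the right hom. *)
Lemma bar_aug_cartesian n (A : ncoll n) k : cartesian (bar_aug A k).
Proof.
move=> X Y f; have cA := nc_cart A (fmap (seqF n k) f).
apply: pullback_of_cells => [j x|j c d cd|j x y e1 e2].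
- exact: (gmap_congr x (ntP (bar_aug A k) f)).
- have e : gm (Tmap n.+1 (fmap (seqF n k) f)) (hc (iota_hcell c)) =
      gm (nc_aug A (mseq Y)) (hc d).
    by rewrite -bar_augE -cd; apply: (esym (iota_nat f c)).
  have [x [x1 x2]] := pullback_cell_ex cA e.
  have [x' [xx' x'c]] := bar_lift x1.
  by exists x'; split=> //; apply: hcell_eq; rewrite /= xx'.
- apply: hcell_eq; apply: (pullback_cell_inj cA).
    by rewrite -!bar_augE e1.
  exact: (congr1 (@hc _ _ _ _) e2).
Qed.

Lemma bar_nat_cartesian n (A B : ncoll n) (f : ncoll_hom A B) k :
  cartesian (bar_nat f k).
Proof.
have e : nt_comp (bar_aug B k) (bar_nat f k) = bar_aug A k.
  by apply: nattrans_eq => X; apply: bar_nat_aug.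
apply: (@cartesian_cancel _ _ _ _ _ (bar_aug B k) (bar_nat f k)).
  exact: bar_aug_cartesian.
by rewrite e; apply: bar_aug_cartesian.
Qed.

Lemma is_pradist_cartesian n (E : forall k, functor (power (GSet n) k) (GSet n))
    (a : forall k, nattrans (E k) (Ttimes n k)) :
  (forall k, cartesian (a k)) -> is_pradist E.
Proof.
move=> ca k; split.
  apply: pra_of_generic; exact: (generic_of_cartesian (ca k) (@generic_Ttimes n k)).
exact: (preserves_each_cartesian (ca k) (@preserves_Ttimes n k)).
Qed.

Lemma bar_wd n : bar_well_defined n.
Proof.
split; last exact: bar_nat_cartesian; last exact: bar_aug_cartesian.
- move=> k; split; last exact: preserves_Ttimes.
  exact: (pra_of_generic (@generic_Ttimes n k)).
- by move=> A; apply: is_pradist_cartesian (@bar_aug_cartesian n A).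
Qed.

(** * Decomposition of cells along sequences *)

Lemma gseq_src0 k (P : 'I_k -> globset) j i (x : P i j) :
  @src0 (gseq P) j.+1 (existT _ i x) = widen_ord (leqnSn k) i.
Proof. by elim: j x => // j IH x; apply: IH (src x). Qed.

Lemma gseq_tgt0 k (P : 'I_k -> globset) j i (x : P i j) :
  @tgt0 (gseq P) j.+1 (existT _ i x) = lift ord0 i.
Proof. by elim: j x => // j IH x; apply: IH (tgt x). Qed.

Section Restriction.
Variables (k : nat) (P : 'I_k -> globset) (X : globset) (h : gmap (gseq P) X).

Definition verts (i : 'I_k.+1) : X 0 := @gm (gseq P) X h 0 i.

Definition restr_fun i j (x : P i j) :
    hcell (verts (widen_ord (leqnSn k) i)) (verts (lift ord0 i)) j :=
  @HCell X _ _ j (@gm (gseq P) X h j.+1 (existT _ i x))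
    (etrans (gm_src0 h _) (congr1 _ (gseq_src0 x)))
    (etrans (gm_tgt0 h _) (congr1 _ (gseq_tgt0 x))).

Program Definition restr i :
    gmap (P i) (ghom (verts (widen_ord (leqnSn k) i)) (verts (lift ord0 i))) :=
  @GMap (P i) (ghom _ _) (@restr_fun i) _ _.
Next Obligation. by move=> i j x; apply: hcell_eq; rewrite /= gm_src. Qed.
Next Obligation. by move=> i j x; apply: hcell_eq; rewrite /= gm_tgt. Qed.

End Restriction.

Section Homs.
Variables (n k : nat) (X : mglobset n.+1).

Definition hseq (v : 'I_k.+1 -> X 0) : power (GSet n) k :=
  fun i => mhom (v (widen_ord (leqnSn k) i)) (v (lift ord0 i)).

Definition hseq_map_fun (v : 'I_k.+1 -> X 0) j : mseq (hseq v) j -> X j :=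
  match j with 0 => v | j'.+1 => fun x => hc (tagged x) end.

Program Definition hseq_map (v : 'I_k.+1 -> X 0) : @hom (GSet n.+1) (mseq (hseq v)) X :=
  @GMap (mseq (hseq v)) X (@hseq_map_fun v) _ _.
Next Obligation. by move=> v [|j] [i x] //=; apply: (hc_src0 x). Qed.
Next Obligation. by move=> v [|j] [i x] //=; apply: (hc_tgt0 x). Qed.

Definition hrestr (S : power (GSet n) k) (h : @hom (GSet n.+1) (mseq S) X) :
    hom S (hseq (verts h)) :=
  fun i => restr h i.

(** A map out of a sequence amounts to its vertices together with maps into the homs between
    consecutive vertices; [hseq_map] is the universal such map for given vertices. *)
Lemma hrestrK (S : power (GSet n) k) (h : @hom (GSet n.+1) (mseq S) X) :
  hseq_map (verts h) ∘ fmap (seqF n k) (hrestr h) = h.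
Proof. by apply: gmap_eq => -[|j] // [i x]. Qed.

Definition Tcomp (v : 'I_k.+1 -> X 0) j (c : Ttimes n k (hseq v) j) : T n.+1 X j.+1 :=
  gm (Tmap n.+1 (hseq_map v)) (hc (iota_hcell c)).

(** Values on 0-cells of the tree determine [v], and values on higher cells then determine the hom
    maps. *)
Lemma Tcomp_inj_same (v v' : 'I_k.+1 -> X 0) j (h h' : j <= n) (p p' : 'I_k -> Tr j)
    (f : forall i, gmap (tree (p i)) (hseq v i)) (f' : forall i, gmap (tree (p' i)) (hseq v' i)) :
  @TCell n.+1 X j.+1 h (existT _ k p) (gcomp (hseq_map v) (gseq_map f)) =
  @TCell n.+1 X j.+1 h' (existT _ k p') (gcomp (hseq_map v') (gseq_map f')) ->
  existT (fun v => forall i, T n (hseq v i) j) v (fun i => TCell h (f i)) =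
  existT (fun v => forall i, T n (hseq v i) j) v' (fun i => TCell h (f' i)).
Proof.
move=> e; have pp' : p = p'.
  exact: (@existT_inj nat (fun k => 'I_k -> Tr j) k _ _ (congr1 (@tc_shape _ _ _) e)).
subst p'.
have E a (x : tree (existT (fun k => 'I_k -> Tr j) k p : Tr j.+1) a) :
    gm (gcomp (hseq_map v) (gseq_map f)) x = gm (gcomp (hseq_map v') (gseq_map f')) x.
  exact: (@tcell_cast n.+1 X j.+1 (@TCell n.+1 X j.+1 h (existT _ k p) _)
    (@TCell n.+1 X j.+1 h' (existT _ k p) _) erefl a x e).
have vv' : v = v' by apply: functional_extensionality_dep => i; apply: (E 0 i).
subst v'; congr existT; apply: functional_extensionality_dep => i.
apply: tcell_eq; apply: gmap_eq => a x; apply: hcell_eq.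
exact: (E a.+1 (existT _ i x)).
Qed.

End Homs.

Section Decomposition.
Variables (n : nat) (X : mglobset n.+1).

Lemma Tcomp_surj j (c : T n.+1 X j.+1) :
  exists k (v : 'I_k.+1 -> X 0) (d : Ttimes n k (hseq v) j), Tcomp d = c.
Proof.
case: c => h [k p] F.
exists k, (verts F), (@PCell n k (fun i => tset n (hseq (verts F) i)) j h
  (fun i => @TCell n (hseq (verts F) i) j h (p i) (restr F i))).
by apply: tcell_eq; apply: gmap_eq => -[|a] // [i x].
Qed.

(** These serve as cells of dimension [j.+1] in the glued object, since passing to homs lowers
    dimension by one. *)
Definition dcell (E : forall k, functor (power (GSet n) k) (GSet n)) (j : nat) : Small :=
  {k : nat & {v : 'I_k.+1 -> X 0 & E k (hseq v) j}}.

Definition dc (E : forall k, functor (power (GSet n) k) (GSet n)) (j k : nat)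
    (v : 'I_k.+1 -> X 0) (e : E k (hseq v) j) : dcell E j :=
  existT _ k (existT _ v e).

Lemma Tcomp_inj j k k' (v : 'I_k.+1 -> X 0) (v' : 'I_k'.+1 -> X 0)
    (d : Ttimes n k (hseq v) j) (d' : Ttimes n k' (hseq v') j) :
  Tcomp d = Tcomp d' -> dc d = dc d'.
Proof.
move=> e; have kk' : k = k' := congr1 (fun c : T n.+1 X j.+1 => projT1 (tc_shape c)) e.
subst k'; case: d d' e => h d [h' d'] e.
have := Tcomp_inj_same e.
have E (w : 'I_k.+1 -> X 0) i (c : T n (hseq w i) j) : TCell h (tc_map c) = c.
  by case: c => *; apply: tcell_eq.
rewrite (_ : (fun i => _) = d); last by apply: functional_extensionality_dep => i; apply: E.
rewrite (_ : (fun i => TCell h _) = d'); last by apply: functional_extensionality_dep => i; apply: E.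
move=> /(congr1 (fun u : {v : 'I_k.+1 -> X 0 & forall i, T n (hseq v i) j} =>
  @dc (Ttimes n) j k (tag u) (@PCell n k (fun i => tset n (hseq (tag u) i)) j h (tagged u)))).
by rewrite (bool_irrelevance h' h).
Qed.

End Decomposition.

Arguments dc {n X} E {j k v} e.

Lemma dc_inj n (E : forall k, functor (power (GSet n) k) (GSet n)) (X : mglobset n.+1)
    k (v : 'I_k.+1 -> X 0) j (e e' : E k (hseq v) j) : dc E e = dc E e' -> e = e'.
Proof. by move=> ee; apply: existT_inj (existT_inj ee). Qed.

Lemma Tcomp_restr n k (S : power (GSet n) k) (X : mglobset n.+1)
    (h : @hom (GSet n.+1) (mseq S) X) j (c : Ttimes n k S j) :
  Tcomp (gm (fmap (Ttimes n k) (hrestr h)) c) = gm (Tmap n.+1 h) (hc (iota_hcell c)).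
Proof. by apply: tcell_eq; apply: gmap_eq => -[|a] // [i x]. Qed.

Section BarComposition.
Variables (n : nat) (A : ncoll n) (X : mglobset n.+1).

Definition bar_comp k (v : 'I_k.+1 -> X 0) j (c : bar_ob A (hseq v) j) : A X j.+1 :=
  gm (fmap A (hseq_map v)) (hc c).

Lemma bar_comp_aug k (v : 'I_k.+1 -> X 0) j (c : bar_ob A (hseq v) j) :
  gm (nc_aug A X) (bar_comp c) = Tcomp (gm (bar_aug A k (hseq v)) c).
Proof.
rewrite /Tcomp bar_augE.
exact: (esym (gmap_congr (hc c) (ntP (nc_aug A) (hseq_map v)))).
Qed.

Lemma bar_comp_surj j (y : A X j.+1) :
  exists k (v : 'I_k.+1 -> X 0) (c : bar_ob A (hseq v) j), bar_comp c = y.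
Proof.
have [k [v [d dP]]] := Tcomp_surj (gm (nc_aug A X) y).
have [x [x1 x2]] := pullback_cell_ex (nc_cart A (hseq_map v)) dP.
have [c [cx _]] := bar_lift x1.
by exists k, v, c; rewrite /bar_comp cx.
Qed.

Lemma bar_comp_inj j k k' (v : 'I_k.+1 -> X 0) (v' : 'I_k'.+1 -> X 0)
    (c : bar_ob A (hseq v) j) (c' : bar_ob A (hseq v') j) :
  bar_comp c = bar_comp c' -> dc (bar_fun A) c = dc (bar_fun A) c'.
Proof.
move=> e; have := congr1 (@gm _ _ (nc_aug A X) _) e.
(* The image in [T X] already fixes length, vertices and augmentation; the pullback square at
   [hseq_map v] then fixes the cell. *)
rewrite !bar_comp_aug => /Tcomp_inj e'.
have kk' : k = k' := congr1 (@tag _ _) e'; subst k'.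
have {}e' := existT_inj e'.
have vv' : v = v' := congr1 (@tag _ _) e'; subst v'.
have {}e' := existT_inj e'.
congr (dc _ _); apply: hcell_eq; apply: (pullback_cell_inj (nc_cart A (hseq_map v))) e.
by rewrite -!bar_augE e'.
Qed.

(** Image under [A] of the factorisation [hrestrK]: it decomposes a cell pushed forward along any
    map out of a sequence. *)
Lemma bar_comp_restr k (S : power (GSet n) k) (h : @hom (GSet n.+1) (mseq S) X) j
    (c : bar_ob A S j) :
  bar_comp (gm (fmap (bar_fun A k) (hrestr h)) c) = gm (fmap A h) (hc c).
Proof.
have := fmapM A (hseq_map (verts h)) (fmap (seqF n k) (hrestr h)).
by rewrite hrestrK => e; apply: (esym (gmap_congr (hc c) e)).
Qed.

End BarComposition.

(** * The functor is fully faithful *)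

Lemma bar_comp_nat n (A B : ncoll n) (f : ncoll_hom A B) (X : mglobset n.+1) k
    (v : 'I_k.+1 -> X 0) j (c : bar_ob A (hseq v) j) :
  bar_comp (gm (bar_nat f k (hseq v)) c) = gm (f X) (bar_comp c).
Proof. exact: (gmap_congr (hc c) (ntP f (hseq_map v))). Qed.

Lemma bar_faithful n : faithful (bar (bar_wd n)).
Proof.
move=> A B f g fg; apply: ncoll_hom_eq => X; apply: gmap_eq => -[|j] y.
  by have [x ->] := nc_ptP y; rewrite !nc_pt_hom.
have [k [v [c <-]]] := bar_comp_surj y; rewrite -!bar_comp_nat; congr bar_comp.
have e : bar_nat f k = bar_nat g k.
  exact: (congr1 (fun u : slice_hom (bar_slice_ob (bar_wd n) A) (bar_slice_ob (bar_wd n) B) =>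
    pd_hom (sl_hom u) k) fg).
by rewrite e.
Qed.

Section Full.
Variables (n : nat) (A B : ncoll n).
Variable phi : forall k, nattrans (bar_fun A k) (bar_fun B k).
Hypothesis phiP : forall k S, bar_aug B k S ∘ phi k S = bar_aug A k S.

Lemma full_ex (X : mglobset n.+1) j (y : A X j.+1) : exists z : B X j.+1,
  forall k (v : 'I_k.+1 -> X 0) (c : bar_ob A (hseq v) j),
    bar_comp c = y -> z = bar_comp (gm (phi k (hseq v)) c).
Proof.
have [k [v [c <-]]] := bar_comp_surj y.
exists (bar_comp (gm (phi k (hseq v)) c)) => k' v' c' e.
(* A function of the whole triple is applied to the equality, which avoids rewriting the length and
   the vertices separately. *)
exact: (congr1 (fun d : dcell X (bar_fun A) j =>
  bar_comp (gm (phi (tag d) (hseq (tag (tagged d)))) (tagged (tagged d))))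
  (esym (bar_comp_inj e))).
Qed.

Definition full_fun (X : mglobset n.+1) j : A X j -> B X j :=
  match j with
  | 0 => fun y => nc_pt B (sval (nc_ptP y))
  | j'.+1 => fun y => sval (cid (full_ex y))
  end.

Lemma full_fun_pt (X : mglobset n.+1) (x : X 0) : full_fun (nc_pt A x) = nc_pt B x.
Proof.
rewrite /=; case: (nc_ptP _) => x' /= e; congr nc_pt; apply: (@vtx_inj n.+1 X).
by rewrite -!(nc_id0 A) -!/(nc_pt _ _) e.
Qed.

(** Allowing an arbitrary [h], and not only [hseq_map v], is what yields compatibility with
    boundaries, naturality and the final comparison with [phi]. It follows from the naturality of
    [phi k] at [hrestr h]. *)
Lemma full_fun_restr (X : mglobset n.+1) k (S : power (GSet n) k)
    (h : @hom (GSet n.+1) (mseq S) X) j (c : bar_ob A S j) :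
  full_fun (gm (fmap A h) (hc c)) = gm (fmap B h) (hc (gm (phi k S) c)).
Proof.
have e := svalP (cid (full_ex (gm (fmap A h) (hc c)))) _ _ _ (bar_comp_restr h c).
rewrite /= e -bar_comp_restr; congr bar_comp.
exact: (esym (gmap_congr c (ntP (phi k) (hrestr h)))).
Qed.

Lemma full_fun_comp (X : mglobset n.+1) k (v : 'I_k.+1 -> X 0) j
    (c : bar_ob A (hseq v) j) :
  full_fun (bar_comp c) = bar_comp (gm (phi k (hseq v)) c).
Proof. exact: full_fun_restr. Qed.

Program Definition full_gmap (X : mglobset n.+1) : @hom (GSet n.+1) (A X) (B X) :=
  @GMap (A X) (B X) (@full_fun X) _ _.
Next Obligation.
move=> X [|j] y; have [k [v [c <-]]] := bar_comp_surj y; rewrite full_fun_comp /bar_comp !gm_src.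
  have -> : src (hc c) = nc_pt A (ord0 : mseq (hseq v) 0) := hc_src0 c.
  have -> : src (hc (gm (phi k (hseq v)) c)) = nc_pt B (ord0 : mseq (hseq v) 0).
    exact: (hc_src0 (gm (phi k (hseq v)) c)).
  by rewrite !nc_pt_map full_fun_pt.
rewrite (full_fun_restr (hseq_map v) (src c)); congr (gm (fmap B (hseq_map v)) _).
exact: (congr1 (@hc _ _ _ _) (gm_src (phi k (hseq v)) c)).
Qed.
Next Obligation.
move=> X [|j] y; have [k [v [c <-]]] := bar_comp_surj y; rewrite full_fun_comp /bar_comp !gm_tgt.
  have -> : tgt (hc c) = nc_pt A (ord_max : mseq (hseq v) 0) := hc_tgt0 c.
  have -> : tgt (hc (gm (phi k (hseq v)) c)) = nc_pt B (ord_max : mseq (hseq v) 0).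
    exact: (hc_tgt0 (gm (phi k (hseq v)) c)).
  by rewrite !nc_pt_map full_fun_pt.
rewrite (full_fun_restr (hseq_map v) (tgt c)); congr (gm (fmap B (hseq_map v)) _).
exact: (congr1 (@hc _ _ _ _) (gm_tgt (phi k (hseq v)) c)).
Qed.

Program Definition full_nt : nattrans A B := @NatTrans _ _ A B full_gmap _.
Next Obligation.
move=> X Y r; apply: gmap_eq => -[|j] y.
  have [x ->] := nc_ptP y.
  apply: (etrans (congr1 (gm (fmap B r)) (full_fun_pt x))).
  apply: (etrans (nc_pt_map B r x)); apply: (etrans (esym (full_fun_pt _))).
  exact: (congr1 (@full_fun Y 0) (esym (nc_pt_map A r x))).
have [k [v [c <-]]] := bar_comp_surj y.
apply: (etrans (congr1 (gm (fmap B r)) (full_fun_comp c))).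
apply: (etrans (esym (gmap_congr _ (fmapM B r (hseq_map v))))).
apply: (etrans (esym (full_fun_restr (r ∘ hseq_map v) c))).
exact: (congr1 (@full_fun Y j.+1) (gmap_congr (hc c) (fmapM A r (hseq_map v)))).
Qed.

Program Definition full_hom : ncoll_hom A B := @NCollHom n A B full_nt _.
Next Obligation.
move=> X; apply: gmap_eq => -[|j] y.
  have [x ->] := nc_ptP y.
  apply: (etrans (congr1 (gm (nc_aug B X)) (full_fun_pt x))).
  by rewrite !nc_id0.
have [k [v [c <-]]] := bar_comp_surj y.
apply: (etrans (congr1 (gm (nc_aug B X)) (full_fun_comp c))).
rewrite !bar_comp_aug; congr Tcomp.
exact: (gmap_congr c (phiP (hseq v))).
Qed.

Lemma bar_full_hom k : bar_nat full_hom k = phi k.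
Proof.
apply: nattrans_eq => S; apply: gmap_eq => j c; apply: hcell_eq.
(* For the identity of the sequence both pushforwards disappear and the formula says that [full_hom]
   restricts to [phi]. *)
have := full_fun_restr (idc (mseq S : GSet n.+1)) c.
by rewrite !fmap1.
Qed.

End Full.

Lemma bar_full n : full (bar (bar_wd n)).
Proof.
move=> A B g.
have gP k S : bar_aug B k S ∘ pd_hom (sl_hom g) k S = bar_aug A k S.
  exact: (congr1 (fun u => pd_hom u k S) (sl_homP g)).
exists (full_hom gP); apply: slice_hom_eq; apply: pradist_hom_eq => k S.
exact: (congr1 (fun u : nattrans _ _ => u S) (bar_full_hom gP k)).
Qed.

(** * The functor is essentially surjective *)

Section Glue.
Variables (n : nat) (E : forall k, functor (power (GSet n) k) (GSet n)).

Section GlueObject.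
Variable X : mglobset n.+1.

Definition glue_cell (j : nat) : Small :=
  match j with 0 => X 0 | j'.+1 => dcell X E j' end.

Definition glue_src j : glue_cell j.+1 -> glue_cell j :=
  match j with
  | 0 => fun d => tag (tagged d) ord0
  | j'.+1 => fun d => dc E (src (tagged (tagged d)))
  end.

Definition glue_tgt j : glue_cell j.+1 -> glue_cell j :=
  match j with
  | 0 => fun d => tag (tagged d) ord_max
  | j'.+1 => fun d => dc E (tgt (tagged (tagged d)))
  end.

Program Definition glue_globset : globset := @GlobSet glue_cell glue_src glue_tgt _ _.
Next Obligation. by case=> // j d; rewrite /= src_glob. Qed.
Next Obligation. by case=> // j d; rewrite /= tgt_glob. Qed.

Program Definition glue_ob : mglobset n.+1 := @MGlobSet n.+1 glue_globset _.
Next Obligation. by case=> // j nj [k [v e]]; apply: (@gset_trunc n (E k (hseq v)) j nj e). Qed.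

Lemma glue_src0 j (d : glue_ob j.+1) : src0 d = tag (tagged d) ord0.
Proof. by elim: j d => // j IH d; apply: (IH (src d)). Qed.

Lemma glue_tgt0 j (d : glue_ob j.+1) : tgt0 d = tag (tagged d) ord_max.
Proof. by elim: j d => // j IH d; apply: (IH (tgt d)). Qed.

End GlueObject.

Definition hseq_hom (X Y : GSet n.+1) (r : hom X Y) k (v : 'I_k.+1 -> X 0) :
    hom (hseq v) (hseq (fun i => gm r (v i))) :=
  hrestr (r ∘ hseq_map v).

Definition glue_map_fun (X Y : GSet n.+1) (r : hom X Y) j : glue_ob X j -> glue_ob Y j :=
  match j with
  | 0 => fun x => gm r x
  | j'.+1 => fun d => dc E (gm (fmap (E (tag d)) (hseq_hom r (tag (tagged d)))) (tagged (tagged d)))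
  end.

Program Definition glue_map (X Y : GSet n.+1) (r : hom X Y) :
    @hom (GSet n.+1) (glue_ob X) (glue_ob Y) :=
  @GMap (glue_ob X) (glue_ob Y) (@glue_map_fun X Y r) _ _.
Next Obligation. by move=> X Y r [|j] d //=; rewrite gm_src. Qed.
Next Obligation. by move=> X Y r [|j] d //=; rewrite gm_tgt. Qed.

Program Definition glue : functor (GSet n.+1) (GSet n.+1) :=
  @Functor (GSet n.+1) (GSet n.+1) glue_ob glue_map _ _.
Next Obligation.
move=> X; apply: gmap_eq => -[|j] // [k [v e]] /=; congr (dc E _).
have h : hseq_hom (idc X) v = idc (hseq v).
  by apply: functional_extensionality_dep => i; apply: gmap_eq => a x; apply: hcell_eq.
by rewrite h; apply: (gmap_congr e (fmap1 (E k) _)).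
Qed.
Next Obligation.
move=> X Y Z s r; apply: gmap_eq => -[|j] // [k [v e]] /=; congr (dc E _).
have h : hseq_hom (s ∘ r) v = hseq_hom s (fun i => gm r (v i)) ∘ hseq_hom r v.
  by apply: functional_extensionality_dep => i; apply: gmap_eq => a x; apply: hcell_eq.
by rewrite h; apply: (gmap_congr e (fmapM (E k) _ _)).
Qed.

End Glue.

Section GlueTrans.
Variables (n : nat) (E E' : forall k, functor (power (GSet n) k) (GSet n)).
Variable a : forall k, nattrans (E k) (E' k).

Definition glue_nt_fun (X : mglobset n.+1) j : glue_ob E X j -> glue_ob E' X j :=
  match j with
  | 0 => fun x => x
  | j'.+1 => fun d => dc E' (gm (a (tag d) (hseq (tag (tagged d)))) (tagged (tagged d)))
  end.

Program Definition glue_nt_map (X : GSet n.+1) : hom (glue E X) (glue E' X) :=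
  @GMap (glue E X) (glue E' X) (@glue_nt_fun X) _ _.
Next Obligation. by move=> X [|j] d //=; rewrite gm_src. Qed.
Next Obligation. by move=> X [|j] d //=; rewrite gm_tgt. Qed.

Program Definition glue_nt : nattrans (glue E) (glue E') :=
  @NatTrans _ _ (glue E) (glue E') glue_nt_map _.
Next Obligation.
move=> X Y r; apply: gmap_eq => -[|j] // [k [v e]] /=; congr (dc E' _).
exact: (gmap_congr e (ntP (a k) (hseq_hom r v))).
Qed.

(** In dimension 0 the map is an identity. Above, a compatible pair of cells shares its length, its
    vertices correspond under [r], and the square becomes that of [a k] at [hseq_hom r v]. *)
Lemma glue_nt_cartesian : (forall k, cartesian (a k)) -> cartesian glue_nt.
Proof.
move=> ca X Y r; apply: pullback_of_cells => [j x|j c d cd|j x y e1 e2].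
- exact: (gmap_congr x (ntP glue_nt r)).
- case: j c d cd => [|j] c d cd; first by exists c.
  case: c d cd => k [v c] [l [w d]] cd.
  have kl : k = l := congr1 (@tag _ _) cd; subst l.
  have vw : (fun i => gm r (v i)) = w := congr1 (@tag _ _) (existT_inj cd); subst w.
  have [x [x1 x2]] := pullback_cell_ex (ca k _ _ (hseq_hom r v)) (dc_inj cd).
  by exists (dc E x); rewrite /= x1 x2.
- case: j x y e1 e2 => [|j] x y e1 e2; first exact: e1.
  case: x y e1 e2 => k [v x] [l [w y]] e1 e2.
  have kl : k = l := congr1 (@tag _ _) e1; subst l.
  have vw : v = w := congr1 (@tag _ _) (existT_inj e1); subst w.
  congr (dc E _); apply: (pullback_cell_inj (ca k _ _ (hseq_hom r v))).
    exact: (dc_inj e1).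
  exact: (dc_inj e2).
Qed.

End GlueTrans.

Section GlueT.
Variable n : nat.

Definition glue_T_fun (X : mglobset n.+1) j : glue_ob (Ttimes n) X j -> T n.+1 X j :=
  match j with
  | 0 => fun x => @vtx n.+1 X x
  | j'.+1 => fun d => Tcomp (tagged (tagged d))
  end.

Program Definition glue_T_map (X : GSet n.+1) : hom (glue (Ttimes n) X) (T n.+1 X) :=
  @GMap (glue (Ttimes n) X) (T n.+1 X) (@glue_T_fun X) _ _.
Next Obligation.
move=> X [|j] [k [v d]]; rewrite [glue_T_fun _]/= /Tcomp gm_src.
  rewrite -[RHS](Tmap_vtx _ (hseq_map v) (ord0 : mseq (hseq v) 0)).
  congr (gm _ _); exact: (hc_src0 (iota_hcell d)).
congr (gm _ _); exact: (congr1 (@hc _ _ _ _) (iota_src d)).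
Qed.
Next Obligation.
move=> X [|j] [k [v d]]; rewrite [glue_T_fun _]/= /Tcomp gm_tgt.
  rewrite -[RHS](Tmap_vtx _ (hseq_map v) (ord_max : mseq (hseq v) 0)).
  congr (gm _ _); exact: (hc_tgt0 (iota_hcell d)).
congr (gm _ _); exact: (congr1 (@hc _ _ _ _) (iota_tgt d)).
Qed.

Program Definition glue_T : nattrans (glue (Ttimes n)) (T n.+1) :=
  @NatTrans _ _ (glue (Ttimes n)) (T n.+1) glue_T_map _.
Next Obligation.
move=> X Y r; apply: gmap_eq => -[|j]; first by move=> x; apply: Tmap_vtx.
move=> [k [v d]]; apply: (etrans _ (esym (Tcomp_restr (r ∘ hseq_map v) d))).
by apply: tcell_eq; apply: gmap_eq.
Qed.

(** Gluing [Ttimes] gives back [T] up to isomorphism; bijectivity is the existence and uniqueness of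
    decompositions. *)
Lemma glue_T_cartesian : cartesian glue_T.
Proof.
apply: iso_cartesian => X; apply: bijective_is_iso => [[|j] x y|[|j] y].
- exact: vtx_inj.
- case: x y => k [v x] [l [w y]]; exact: Tcomp_inj.
- case: y => h [] f; exists (@gm point X f 0 tt).
  by apply: tcell_eq; apply: gmap_eq => -[|a] [].
- by have [k [v [d <-]]] := Tcomp_surj y; exists (dc (Ttimes n) d).
Qed.

End GlueT.

Lemma hrestr_id_iso n k (X : power (GSet n) k) : is_iso (hrestr (idc (mseq X : GSet n.+1))).
Proof.
apply: power_iso => i; apply: bijective_is_iso => [j x y e|j [[i' x] s t]].
  exact: (existT_inj (congr1 (@hc _ _ _ _) e)).
have ii : i' = i.
  by apply: val_inj; move: (congr1 val (etrans (esym (gseq_src0 x)) s)).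
by subst i'; exists x; apply: hcell_eq.
Qed.

Section GlueCollection.
Variables (n : nat) (E : pradist n) (a : forall k, nattrans (E k) (Ttimes n k)).
Hypothesis ca : forall k, cartesian (a k).

(** With [erefl] for [nc_dim0], [nc_pt] computes to the identity, and [unglue_cell] may use plain
    vertices as end points. *)
Program Definition glue_coll : ncoll n :=
  @NColl n (glue E) (nt_comp (glue_T n) (glue_nt a)) _ (fun X => erefl) _.
Next Obligation. exact: (cartesian_comp (@glue_T_cartesian n) (glue_nt_cartesian ca)). Qed.

(** The cell is placed over the chain of all vertices 0, 1, .., k, whose consecutive homs are the
    entries of [X] up to the isomorphism [hrestr_id_iso]. *)
Definition unglue_cell k (X : power (GSet n) k) j (e : E k X j) : bar_ob glue_coll X j :=
  @HCell (glue E (mseq X)) (ord0 : mseq X 0) (ord_max : mseq X 0) j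
    (dc E (gm (fmap (E k) (hrestr (idc (mseq X : GSet n.+1)))) e))
    (glue_src0 (X := mseq X) _) (glue_tgt0 (X := mseq X) _).

Program Definition unglue_map k (X : power (GSet n) k) : hom (E k X) (bar_fun glue_coll k X) :=
  @GMap (E k X) (bar_fun glue_coll k X) (@unglue_cell k X) _ _.
Next Obligation. by move=> k X j e; apply: hcell_eq; rewrite /= gm_src. Qed.
Next Obligation. by move=> k X j e; apply: hcell_eq; rewrite /= gm_tgt. Qed.

Program Definition unglue k : nattrans (E k) (bar_fun glue_coll k) :=
  @NatTrans _ _ (E k) (bar_fun glue_coll k) (@unglue_map k) _.
Next Obligation.
move=> k X Y r; apply: gmap_eq => j e; apply: hcell_eq; congr (dc E _).
set h := hseq_hom _ _.
have hE : h ∘ hrestr (idc (mseq X : GSet n.+1)) = hrestr (idc (mseq Y : GSet n.+1)) ∘ r.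
  by apply: functional_extensionality_dep => i; apply: gmap_eq => b x; apply: hcell_eq.
have := etrans (esym (fmapM (E k) _ _)) (etrans (congr1 (fmap (E k)) hE) (fmapM (E k) _ _)).
exact: gmap_congr.
Qed.

Lemma unglue_inj k (X : power (GSet n) k) j : injective (@unglue_cell k X j).
Proof.
move=> e e' /(congr1 (@hc _ _ _ _)) /= /dc_inj.
by apply: iso_cell_inj; apply: fmap_iso; apply: hrestr_id_iso.
Qed.

Lemma unglue_surj k (X : power (GSet n) k) j (c : bar_ob glue_coll X j) :
  exists e, unglue_cell e = c.
Proof.
case: c => [[l [v d]] s t].
have v0 : v ord0 = ord0 := 
  etrans (esym (@glue_src0 n E (mseq X) j (dc E d))) s.
have vm : v ord_max = ord_max := 
  etrans (esym (@glue_tgt0 n E (mseq X) j (dc E d))) t.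
(* The augmentation of [d] is a map from a tree to the sequence with vertices [v]. Each branch
   contains a 0-cell, so [gseq_map0] forces [v i = i], and the last vertex gives [l = k]. *)
pose F := tc_map (Tcomp (gm (a l (hseq v)) d)).
have vE := @gseq_map0 l k _ (fun i => gset (X i)) F (fun i => tree_pt _) v0.
have lk : l = k by rewrite -[LHS](vE ord_max) -[RHS]/(val (ord_max : 'I_k.+1)) -vm.
subst l; have vid : v = verts (idc (mseq X : GSet n.+1)).
  by apply: functional_extensionality_dep => i; apply: val_inj; apply: vE.
subst v.
have [e eP] := iso_cell_surj d (fmap_iso (E k) (hrestr_id_iso X)).
by exists e; apply: hcell_eq; rewrite /= eP.
Qed.

Lemma unglue_iso k X : is_iso (unglue k X).
Proof. by apply: bijective_is_iso => j; [apply: unglue_inj|apply: unglue_surj]. Qed.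

Lemma unglue_aug k X : bar_aug glue_coll k X ∘ unglue k X = a k X.
Proof.
apply: gmap_eq => j e; apply: iota_inj; apply: hcell_eq.
apply: (etrans (bar_augE _)).
pose h := idc (mseq X : GSet n.+1).
apply: (@etrans _ _ (Tcomp (gm (fmap (Ttimes n k) (hrestr h)) (gm (a k X) e)))).
  by congr Tcomp; apply: (esym (gmap_congr e (ntP (a k) (hrestr h)))).
by rewrite Tcomp_restr; apply: tcell_eq; apply: gmap_eq.
Qed.

End GlueCollection.

Lemma bar_surj n : essentially_surjective (bar (bar_wd n)).
Proof.
move=> [E a]; pose A := glue_coll (pd_cart a); exists A.
have ui k X := unglue_iso (pd_cart a) X : is_iso (unglue (pd_cart a) k X).
have [b bP] : exists b : forall k, nattrans (bar_fun A k) (E k), forall k,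
    nt_comp (b k) (unglue (pd_cart a) k) = nt_id _ /\
    nt_comp (unglue (pd_cart a) k) (b k) = nt_id _.
  pose bk k := cid (nattrans_inverse (ui k)).
  by exists (fun k => sval (bk k)) => k; apply: svalP (bk k).
have bu k X : b k X ∘ unglue (pd_cart a) k X = idc _.
  exact: (congr1 (fun f : nattrans _ _ => f X) (proj1 (bP k))).
have ub k X : unglue (pd_cart a) k X ∘ b k X = idc _.
  exact: (congr1 (fun f : nattrans _ _ => f X) (proj2 (bP k))).
have cb k : cartesian (b k).
  (* Morphisms of [PRADIST] must be cartesian, which invertibility of the components guarantees. *)
  by apply: iso_cartesian => X; exists (unglue (pd_cart a) k X).
have cu k : cartesian (unglue (pd_cart a) k) by apply: iso_cartesian.
pose u' : @hom (PRADIST n) E (PraDist (wd_fun (bar_wd n) A)) :=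
  @PraDistHom n E (PraDist (wd_fun (bar_wd n) A)) _ cu.
pose b' : @hom (PRADIST n) (PraDist (wd_fun (bar_wd n) A)) E :=
  @PraDistHom n (PraDist (wd_fun (bar_wd n) A)) E _ cb.
have uP : sl_arr (bar_slice_ob (bar_wd n) A) ∘ u' = a.
  by apply: pradist_hom_eq => k X; apply: unglue_aug.
have bP' : a ∘ b' = sl_arr (bar_slice_ob (bar_wd n) A).
  apply: pradist_hom_eq => k X; rewrite -uP.
  apply: (etrans (esym (cmpA (bar_aug A k X) (unglue (pd_cart a) k X) (b k X)))).
  by rewrite ub cmp1.
exists (@SliceHom (PRADIST n) _ (bar_slice_ob (bar_wd n) A) (SliceOb a) b' bP').
exists (@SliceHom (PRADIST n) _ (SliceOb a) (bar_slice_ob (bar_wd n) A) u' uP).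
by split; apply: slice_hom_eq; apply: pradist_hom_eq => k X; [apply: ub|apply: bu].
Qed.

Theorem theorem8p2 (n : nat) :
  exists wd : bar_well_defined n, is_equivalence (bar wd).
Proof.
exists (bar_wd n); apply: equivalence_of_ff_surj.
- exact: bar_faithful.
- exact: bar_full.
- exact: bar_surj.
Qed.
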